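(* Let $(X,0)$ be an isolated, quasi-homogeneous hypersurface singularity in $\mathbb{C}^n$, $n\geq3$, and let $D\subset X$ be an integral horizontal divisor. Then there exists a $\mathbb{C}^*$-divisor $E\subset X$ such that $D$ is CI-linked to $E$.
   Context: $X\subset\mathbb{C}^n$ is an integral, normal hypersurface defined by $F$, with only an isolated singularity at the origin $0$. Quasi-homogeneous with weights $\underline{\omega}=(\omega_1,\dots,\omega_n)$: there are positive integers $\omega_1,\dots,\omega_n,d$ with $F(\lambda^{\omega_1}X_1,\dots,\lambda^{\omega_n}X_n)=\lambda^dF(X_1,\dots,X_n)$ for all $\lambda\in\mathbb{C}^*$. The group $\mathbb{C}^*$ acts on $X$ by $\lambda\cdot(x_1,\dots,x_n)=(\lambda^{\omega_1}x_1,\dots,\lambda^{\omega_n}x_n)$. Let $X^*:=X\setminus\{0\}$, let $\mathbb{P}^{\underline{\omega}}_{X^*}$ be the quotient of $X^*$ by this action, and $\pi_X:X^*\to\mathbb{P}^{\underline{\omega}}_{X^*}$ the quotient map. An integral divisor $D\subset X$ is horizontal if the composition $D\setminus\{0\}\subset X\setminus\{0\}\xrightarrow{\pi_X}\mathbb{P}^{\underline{\omega}}_{X^*}$ is dominant. An integral divisor $D$ in $X^*$ is a $\mathbb{C}^*$-divisor if $D=\pi_X^{-1}(D')_{\mathrm{red}}$ for some integral Weil divisor $D'$ in $\mathbb{P}^{\underline{\omega}}_{X^*}$; an integral divisor in $X$ is a $\mathbb{C}^*$-divisor if it is the closure of an integral $\mathbb{C}^*$-divisor of $X^*$. In general, $\mathbb{C}^*$-divisors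 on $X$ are elements of the free abelian group generated by integral $\mathbb{C}^*$-divisors of $X$ (modulo linear equivalence). Two distinct divisors $D,E$ are CI-linked if there exists a polynomial $g\in\mathbb{C}[[X_1,\dots,X_n]]$ such that $D\cup E=Z(g)\cap X$, where $Z(g)$ is the zero locus of $g$. *)

(* Defs.v *)
From HB Require Import structures.
From mathcomp Require Import all_boot all_order all_algebra.
From mathcomp Require Import boolp classical_sets functions reals.
From mathcomp Require Import topology_structure subtype_topology quotient_topology.
From mathcomp Require Import complex.
From mathcomp Require Import freeg mpoly.

Set Implicit Arguments.
Unset Strict Implicit.
Unset Printing Implicit Defensive.

Import Order.TTheory GRing.Theory Num.Theory.

Local Open Scope classical_set_scope.
Local Open Scope quotient_scope.
Local Open Scope ring_scope.

Section Topology.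
Variable T : topologicalType.
Implicit Types Z : set T.

Definition irreducible_closed (Z : set T) : Prop :=
  [/\ closed Z, Z !=set0 &
      forall B C : set T, closed B -> closed C ->
        Z `<=` B `|` C -> Z `<=` B \/ Z `<=` C].

(* Z = c 0 < c 1 < ... < c k, all irreducible and closed in T *)
Definition irreducible_chain (Z : set T) (k : nat) : Prop :=
  exists c : nat -> set T,
    [/\ c 0%N = Z,
        forall i, (i <= k)%N -> irreducible_closed (c i) &
        forall i, (i < k)%N -> c i `<` c i.+1].

Definition has_codim (Z : set T) (k : nat) : Prop :=
  irreducible_chain Z k /\
  forall m, irreducible_chain Z m -> (m <= k)%N.

(* An integral closed subscheme of a variety is recorded by its set of points. *)
Definition integral_divisor (Z : set T) : Prop :=
  irreducible_closed Z /\ has_codim Z 1.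

End Topology.

(* An alias, so that the Zariski topology does not compete with the topology
   that row vectors inherit from their entries. *)
Definition affine (n : nat) (K : fieldType) : Type := 'rV[K]_n.

HB.instance Definition _ n K := Choice.on (affine n K).

Definition mev n (K : fieldType) (p : {mpoly K[n]}) (x : affine n K) : K :=
  p.@[(x : 'rV[K]_n) 0].

Definition zero_locus n (K : fieldType) (S : set {mpoly K[n]}) :
  set (affine n K) := [set x | forall p, S p -> mev p x = 0].

Section Zariski.
Variables (n : nat) (K : fieldType).

Definition zariski_open (U : set (affine n K)) : Prop :=
  exists S : set {mpoly K[n]}, ~` U = zero_locus S.

Lemma zariski_openT : zariski_open setT.
Proof.
exists [set 1]; rewrite setCT; apply/seteqP; split=> // x /(_ 1 erefl).
by rewrite /mev meval1 => /eqP; rewrite oner_eq0.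
Qed.

Lemma zariski_openI : setI_closed zariski_open.
Proof.
move=> U V [S US] [T VT].
exists [set p | exists s t, [/\ S s, T t & p = s * t]].
rewrite setCI US VT; apply/seteqP; split=> x /=.
  move=> H p [s [t [Ss Tt ->]]]; rewrite /mev mevalM.
  case: H => H; first by have := H s Ss; rewrite /mev => ->; rewrite mul0r.
  by have := H t Tt; rewrite /mev => ->; rewrite mulr0.
move=> H; have [|NS] := pselect (zero_locus S x); first by left.
right=> t Tt; apply: contrapT => tx; apply: NS => s Ss; apply: contrapT => sx.
have /eqP : mev (s * t) x = 0 by apply: H; exists s, t.
by rewrite /mev mevalM mulf_eq0 => /orP[] /eqP.
Qed.

Lemma zariski_open_bigU (I : Type) (f : I -> set (affine n K)) :
  (forall i, zariski_open (f i)) -> zariski_open (\bigcup_i f i).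
Proof.
move=> /choice[S fS]; exists [set p | exists i, S i p].
rewrite setC_bigcup; apply/seteqP; split=> x /=.
  by move=> Hx p [j]; have := Hx j Logic.I; rewrite fS => /(_ p).
by move=> Hx j _; rewrite fS => p Sp; apply: Hx; exists j.
Qed.

HB.instance Definition _ := isOpenTopological.Build (affine n K)
  zariski_openT zariski_openI zariski_open_bigU.

End Zariski.

Section Hypersurface.
Variables (n : nat) (K : fieldType) (F : {mpoly K[n]}).

Definition hypersurface : set (affine n K) := [set x | mev F x = 0].

Definition singular_point (x : hypersurface) : Prop :=
  forall i : 'I_n, mev (mderiv i F) (set_val x) = 0.

Definition is_origin (x : hypersurface) : Prop :=
  set_val x = (0 : 'rV[K]_n).

Definition isolated_singularity : Prop :=
  forall x : hypersurface, singular_point x <-> is_origin x.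

(* phi presents A as K[X_1, ..., X_n] / (F) *)
Definition is_coordinate_ring (A : comNzRingType)
    (phi : {rmorphism {mpoly K[n]} -> A}) : Prop :=
  (forall a, exists p, phi p = a) /\
  (forall p, phi p = 0 <-> exists q, p = q * F).

Definition integrally_closed (A : idomainType) : Prop :=
  forall z : {fraction A}, integralOver (@FracField.tofrac A) z ->
    exists a : A, z = FracField.tofrac a.

Definition integral_normal : Prop :=
  exists (A : idomainType) (phi : {rmorphism {mpoly K[n]} -> A}),
    is_coordinate_ring phi /\ integrally_closed A.

(* X minus the origin, as a subset of X *)
Definition punctured : set hypersurface := [set x | ~ is_origin x].

Definition hypersurface_section (g : {mpoly K[n]}) : set hypersurface :=
  [set x | mev g (set_val x) = 0].

(* the free abelian group on the subsets of X: it contains the group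
   of divisors, cut out by a condition on the generators that occur *)
Definition divisor : Type := {freeg (set hypersurface)}.

Definition effective (E : divisor) : Prop := forall Y, 0 <= coeff Y E.

Definition divisor_support (E : divisor) : set hypersurface :=
  [set x | exists2 Y : set hypersurface, coeff Y E != 0 & Y x].

Definition CI_linked (D E : divisor) : Prop :=
  D <> E /\
  exists g : {mpoly K[n]},
    divisor_support D `|` divisor_support E = hypersurface_section g.

End Hypersurface.

Arguments punctured {n K} F.

Section Weights.
Variables (n : nat) (K : fieldType) (w : 'I_n -> nat).

Definition quasi_homogeneous (d : nat) (F : {mpoly K[n]}) : Prop :=
  [/\ forall i, (0 < w i)%N, (0 < d)%N &
      forall lam : K, lam != 0 ->
        F \mPo [tuple lam ^+ w i *: 'X_i | i < n] = lam ^+ d *: F].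

Definition weighted_action (lam : K) (x : affine n K) : affine n K :=
  \row_i (lam ^+ w i * (x : 'rV[K]_n) 0 i).

Variable F : {mpoly K[n]}.

Definition same_orbit : rel (punctured F) := fun x y =>
  `[< exists lam : K, lam != 0 /\
      set_val (set_val y) = weighted_action lam (set_val (set_val x)) >].

Lemma same_orbit_equiv : equiv_class_of same_orbit.
Proof.
split=> [x|x y|y x z].
- apply/asboolP; exists 1; split; first exact: oner_neq0.
  by apply/rowP => i; rewrite mxE expr1n mul1r.
- apply: asbool_equiv_eq; split=> -[lam [lam0 ->]]; exists lam^-1;
    rewrite invr_eq0; split=> //; apply/rowP => i.
    by rewrite !mxE mulrA -exprMn mulVf // expr1n mul1r.
  by rewrite !mxE mulrA -exprMn mulVf // expr1n mul1r.
- move=> /asboolP[lam [lam0 Hy]] /asboolP[mu [mu0 Hz]].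
  apply/asboolP; exists (mu * lam); split; first exact: mulf_neq0.
  by rewrite Hz Hy; apply/rowP => i; rewrite !mxE exprMn mulrA.
Qed.

Canonical same_orbit_equiv_rel := EquivRelPack same_orbit_equiv.

(* The quotient of X^* by the weighted action, with the quotient topology of the
   Zariski topology: the closed points of the weighted projective variety. *)
Definition orbit_space : topologicalType :=
  quotient_topology {eq_quot same_orbit}.

Definition orbit_map (x : punctured F) : orbit_space :=
  \pi_{eq_quot same_orbit} x.

(* dominance of the composition of D \ {0} -> X^* with orbit_map *)
Definition horizontal (D : set (hypersurface F)) : Prop :=
  dense (orbit_map @` (set_val @^-1` D)).

Definition punctured_Cstar_divisor (Y : set (punctured F)) : Prop :=
  integral_divisor Y /\
  exists D' : set orbit_space,
    integral_divisor D' /\ Y = orbit_map @^-1` D'.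

Definition integral_Cstar_divisor (Y : set (hypersurface F)) : Prop :=
  integral_divisor Y /\
  exists Y0 : set (punctured F),
    punctured_Cstar_divisor Y0 /\ Y = closure (set_val @` Y0).

Definition Cstar_divisor (E : divisor F) : Prop :=
  forall Y, coeff Y E != 0 -> integral_Cstar_divisor Y.

End Weights.

(* Main.v *)
Require Import Defs.
From HB Require Import structures.
From mathcomp Require Import all_boot all_order all_algebra.
From mathcomp Require Import boolp classical_sets functions reals.
From mathcomp Require Import topology_structure subtype_topology quotient_topology.
From mathcomp Require Import complex.
From mathcomp Require Import freeg mpoly ring zify.

(* Invert the weighted homogeneous functions on X: the coordinate ring becomes a
   principal ideal domain k[t, 1/t] with k a field. So there are g in I(D) and a
   homogeneous s, nonzero on X, with Z(g) contained in the union of D and Z(s) on X,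
   and Z(gs) is the union of D and Z(s). Take for E the sum of the components of
   Z(s). By Krull's principal ideal theorem and the Nullstellensatz they have
   codimension one in X. They are stable under the torus, because the torus is
   irreducible, and none of them is the origin, because the closure of an orbit lies
   strictly between the origin and X. Finally D is not one of them, since a
   horizontal divisor is not contained in Z(s). *)

(** The functions on X form a domain graded by the weights, and inverting its nonzero homogeneous
    elements leaves Laurent polynomials over a field. That localization is never built: division
    with remainder is carried out on polynomials, the number of consecutive weights serving as
    Euclidean size. The obstacle is that codimension one is required in X, in X^* and in the orbit
    space, and the last is a bare topological quotient without coordinate ring. Dimension theory is
    therefore used on X only. There codimension one becomes maximality among the proper irreducible
    closed subsets, an order-theoretic property. It passes to X^* by taking closures, and to the
    quotient because closed sets there are the closed saturated sets of X^*. The bound on [n] leaves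
    two coordinates besides any given one, which makes X large enough for a point not to be a
    divisor. *)

Set Implicit Arguments.
Unset Strict Implicit.
Unset Printing Implicit Defensive.
Import Order.TTheory GRing.Theory Num.Theory.
Local Open Scope classical_set_scope.
Local Open Scope quotient_scope.
Local Open Scope ring_scope.

(** * Ideals and Krull's principal ideal theorem *)

Section Ideals.
Variable A : comNzRingType.
Implicit Types (I J P Q : set A) (L : seq A).

Definition ideal I : Prop :=
  [/\ I 0, forall x y, I x -> I y -> I (x + y) & forall a x, I x -> I (a * x)].

Definition prime_ideal P : Prop :=
  [/\ ideal P, ~ P 1 & forall a b, P (a * b) -> P a \/ P b].

(** Leastness among the ideals that contain [L] replaces explicit linear combinations. *)
Definition generates L I : Prop :=
  (forall x, x \in L -> I x) /\
  forall J, ideal J -> (forall x, x \in L -> J x) -> I `<=` J.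

Definition noetherian : Prop :=
  forall I, ideal I -> exists L, generates L I.

Lemma idealN I x : ideal I -> I x -> I (- x).
Proof. by case=> _ _ IM Ix; rewrite -mulN1r; exact: IM. Qed.

Lemma idealB I x y : ideal I -> I x -> I y -> I (x - y).
Proof. by move=> II Ix Iy; case: (II) => _ ID _; apply: ID (idealN II Iy). Qed.

Lemma idealMr I x a : ideal I -> I x -> I (x * a).
Proof. by case=> _ _ IM Ix; rewrite mulrC; exact: IM. Qed.

Lemma idealBK I x y : ideal I -> I (x - y) -> I y -> I x.
Proof. by move=> [_ ID _] Ixy Iy; rewrite -(subrK y x); exact: ID. Qed.

Lemma prime_idealX P a k : prime_ideal P -> ~ P a -> ~ P (a ^+ k).
Proof.
move=> [_ P1 PM] Pa; elim: k => [|k IHk]; first by rewrite expr0.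
by rewrite exprS => /PM[].
Qed.

Lemma prime_idealMn P a b : prime_ideal P -> ~ P a -> ~ P b -> ~ P (a * b).
Proof. by move=> [_ _ PM] Pa Pb /PM[]. Qed.

Lemma ideal_principal a : ideal [set x | exists b, x = b * a].
Proof.
split=> /=; first by exists 0; rewrite mul0r.
- by move=> x y [b ->] [c ->]; exists (b + c); rewrite mulrDl.
- by move=> c x [b ->]; exists (c * b); rewrite mulrA.
Qed.

Lemma idealD_principal I a : 
  ideal I -> ideal [set x | exists2 y, I y & exists b, x = y + b * a].
Proof.
move=> [I0 ID IM]; split=> /=; first by exists 0 => //; exists 0; rewrite mul0r addr0.
- move=> x y [x1 Ix1 [b ->]] [y1 Iy1 [c ->]].
  by exists (x1 + y1); [exact: ID | exists (b + c); rewrite mulrDl addrACA].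
- move=> c x [x1 Ix1 [b ->]].
  by exists (c * x1); [exact: IM | exists (c * b); rewrite mulrDr mulrA].
Qed.

Lemma ideal_colon I a : ideal I -> ideal [set x | I (x * a)].
Proof.
move=> [I0 ID IM]; split=> /= [|x y|c x]; first by rewrite mul0r.
- by rewrite mulrDl; exact: ID.
- by rewrite -mulrA; exact: IM.
Qed.

(** Without a maximal element, choice yields a strictly increasing chain in [S]; the generators of
    its union already lie in one term. *)
Lemma noetherian_max (S : set (set A)) :
  noetherian -> (forall I, S I -> ideal I) -> S !=set0 ->
  exists2 I, S I & forall J, S J -> I `<=` J -> J = I.
Proof.
move=> nA SI [I0 SI0]; apply: contrapT => noMax.
have /choice[f fP] : forall I : {I | S I}, exists J : {J | S J},
    sval I `<=` sval J /\ ~ (sval J `<=` sval I).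
  move=> [I SI1]; apply: contrapT => no; apply: noMax; exists I => // J SJ IJ.
  apply/seteqP; split=> //; apply: contrapT => nJI; apply: no.
  by exists (exist _ J SJ).
pose c k := sval (iter k f (exist _ I0 SI0)).
have cS k : S (c k) by exact: svalP.
have cmono : forall j k, (j <= k)%N -> c j `<=` c k.
  move=> j k /subnK <-; elim: (k - j)%N => [//|i IHi].
  by apply: (subset_trans IHi); case: (fP (iter (i + j) f (exist _ I0 SI0))).
have cI : ideal (\bigcup_k c k).
  split.
  - by exists 0%N => //; case: (SI _ (cS 0%N)).
  - move=> x y [j _ cx] [k _ cy]; exists (maxn j k) => //.
    case: (SI _ (cS (maxn j k))) => _ + _; apply.
      exact: (cmono _ _ (leq_maxl _ _)).
    exact: (cmono _ _ (leq_maxr _ _)).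
  - by move=> a x [k _ cx]; exists k => //; case: (SI _ (cS k)) => _ _; apply.
have [L [Lc genL]] := nA _ cI.
have [k Lk] : exists k, forall x, x \in L -> c k x.
  elim: L {genL} Lc => [|a L IHL] Lc; first by exists 0%N.
  have [|k Lk] := IHL; first by move=> x xL; apply: Lc; rewrite inE xL orbT.
  have [j _ ca] := Lc a (mem_head _ _).
  exists (maxn j k) => x; rewrite inE => /predU1P[->|xL].
    exact: (cmono _ _ (leq_maxl j k)).
  exact: (cmono _ _ (leq_maxr j k) _ (Lk _ xL)).
have := genL (c k) (SI _ (cS k)) Lk.
case: (fP (iter k f (exist _ I0 SI0))) => _ nck ck; apply: nck => x cx.
by apply: ck; exists k.+1.
Qed.

End Ideals.

Section Krull.
Variable A : comNzRingType.
Implicit Types (I J P Q : set A) (L : seq A).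

(* [locally_sub P I J] says that I is contained in J after localization at P,
   when I is finitely generated. *)
Definition locally_sub P I J := exists2 c, ~ P c & forall x, I x -> J (c * x).

(** The descending chain condition above [I] in the local ring at [P]. The denominator may depend on
    [k]: a single step of the chain is all that Krull's theorem uses. *)
Definition chain_stabilizes P I :=
  forall J : nat -> set A, (forall k, [/\ ideal (J k), I `<=` J k & J k.+1 `<=` J k]) ->
  exists k0, forall k, (k0 <= k)%N -> locally_sub P (J k) (J k.+1).

(* The local ring at a minimal prime of [s] is Artinian modulo [s]: an ideal
   maximal among the ideals containing [s] without the descending chain
   condition would have to be prime, hence equal to [P]. *)
Lemma minimal_prime_chain_stabilizes P s :
  noetherian A -> prime_ideal P -> P s ->
  (forall Q, prime_ideal Q -> Q s -> Q `<=` P -> Q = P) ->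
  chain_stabilizes P [set x | exists b, x = b * s].
Proof.
move=> nA prP Ps minP; apply: contrapT => bad.
have [] := @noetherian_max A
  [set I | [/\ ideal I, I s & ~ chain_stabilizes P I]] nA.
- by move=> I [].
- exists [set x | exists b, x = b * s]; split=> //; first exact: ideal_principal.
  by exists 1; rewrite mul1r.
move=> I [idI Is badI] maxI.
have good J : ideal J -> I `<=` J -> ~ (J `<=` I) -> chain_stabilizes P J.
  move=> idJ IJ nJI; apply: contrapT => badJ; apply: nJI.
  by rewrite (maxI J) //; split => //; exact: IJ.
(* An element of [I] outside [P] would itself serve as denominator for every chain above [I]. *)
have IP : I `<=` P.
  move=> c Ic; apply: contrapT => nPc; apply: badI => J JP.
  exists 0%N => k _; exists c => // x _.
  by have [idJ IJ _] := JP k.+1; apply: idealMr => //; exact: IJ.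
have [idP P1 _] := prP.
have chain_sub (J : nat -> set A) :
    (forall k, [/\ ideal (J k), I `<=` J k & J k.+1 `<=` J k]) ->
    forall j k, (j <= k)%N -> J k `<=` J j.
  move=> JP j k /subnK <-; elim: (k - j)%N => [//|i IHi].
  by apply: subset_trans IHi; case: (JP (i + j)%N).
(* If [I] is prime, it is [P]. From the first term inside [P] on, a chain is then constantly [P]; if
   there is no such term, each term contains an element outside [P], a unit of the local ring. *)
have [prI|] := pselect (forall a b, I (a * b) -> I a \/ I b).
  have eqIP : I = P by apply: minP => //; split=> // /IP.
  apply: badI => J JP; have [[k JkP]|nJP] := pselect (exists k, J k `<=` P).
    exists k => j kj; exists 1 => // x Jx; rewrite mul1r.
    case: (JP j.+1) => _ + _; apply; rewrite eqIP; apply: JkP.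
    exact: chain_sub JP _ _ kj _ Jx.
  exists 0%N => k _; have [c Jc Pc] : exists2 c, J k.+1 c & ~ P c.
    apply: contrapT => h; apply: nJP; exists k.+1 => c Jc.
    by apply: contrapT => Pc; apply: h; exists c.
  by exists c => // x _; apply: idealMr => //; case: (JP k.+1).
move=> /existsNP[a /existsNP[b /not_implyP[Iab /not_orP[nIa nIb]]]].
have [I0 ID IM] := idI.
(* Both [I + (a)] and [I : a] are strictly larger than [I], the second because it contains [b]. A
   chain [J] is governed by [J + (a)] and [J : a], since [A / J] is an extension of [A / (J + (a))]
   by [A / (J : a)]. *)
have goodD : chain_stabilizes P [set x | exists2 y, I y & exists b, x = y + b * a].
  apply: good; first exact: idealD_principal.
    by move=> x Ix; exists x => //; exists 0; rewrite mul0r addr0.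
  move=> /(_ a); apply: contra_not nIa; apply; exists 0 => //.
  by exists 1; rewrite mul1r add0r.
have goodC : chain_stabilizes P [set x | I (x * a)].
  apply: good; first exact: ideal_colon.
    by move=> x Ix; exact: idealMr.
  by move=> /(_ b); apply: contra_not nIb; apply; rewrite /= mulrC.
apply: badI => J JP.
have [|k1 st1] := goodD (fun k => [set x | exists2 y, J k y & exists b, x = y + b * a]).
  move=> k; have [idJ IJ JJ] := JP k; split; first exact: idealD_principal.
    by move=> x [y Iy xE]; exists y => //; exact: IJ.
  by move=> x [y Jy xE]; exists y => //; exact: JJ.
have [|k2 st2] := goodC (fun k => [set x | J k (x * a)]).
  move=> k; have [idJ IJ JJ] := JP k; split; first exact: ideal_colon.
    by move=> x /IJ.
  by move=> x /JJ.
exists (maxn k1 k2) => k; rewrite geq_max => /andP[/st1 [c1 Pc1 h1] /st2 [c2 Pc2 h2]].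
exists (c2 * c1) => [|x Jx]; first exact: prime_idealMn.
have [idJ IJ JJ] := JP k; have [idJ' _ _] := JP k.+1.
have [|y Jy [t xE]] := h1 x; first by exists x => //; exists 0; rewrite mul0r addr0.
rewrite -mulrA xE mulrDr; case: (idJ') => _ JD JM; apply: JD; first exact: JM.
rewrite mulrA; apply: h2 => /=.
have -> : t * a = c1 * x - y by rewrite xE addrC addKr.
by apply: idealB => //; [case: idJ => _ _; apply | exact: JJ].
Qed.

(* Nakayama's lemma in the local ring at P: the generators [L] are
   eliminated one at a time. *)
Lemma nakayama P s c L I N :
  prime_ideal P -> P s -> ideal N -> ideal I -> ~ P c ->
  (forall J, ideal J -> N `<=` J -> (forall x, x \in L -> J x) -> I `<=` J) ->
  (forall x, I x -> exists2 y, N y & exists2 z, I z & c * x = y + s * z) ->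
  (forall x, x \in L -> I x) -> N `<=` I ->
  locally_sub P I N.
Proof.
move=> prP Ps idN; have [idP P1 _] := prP; have [N0 ND NM] := idN.
elim: L I c => [|g L IHL] I c idI Pc genI cI LI NI.
  by exists 1 => // x Ix; rewrite mul1r; exact: (genI N).
pose I' : set A := [set x |
  forall J, ideal J -> N `<=` J -> (forall x, x \in L -> J x) -> J x].
have idI' : ideal I'.
  split=> [J [] //|x y Ix Iy J idJ NJ LJ|a x Ix J idJ NJ LJ].
    by case: (idJ) => _ JD _; apply: JD; [exact: Ix | exact: Iy].
  by case: (idJ) => _ _; apply; exact: Ix.
have [I'0 I'D I'M] := idI'.
have I'I : I' `<=` I by move=> x; apply=> // y yL; apply: LI; rewrite inE yL orbT.
have NI' : N `<=` I' by move=> x Nx J _ NJ _; exact: NJ.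
have I'P x : I x -> exists2 y, I' y & exists b, x = y + b * g.
  apply: (genI _ (idealD_principal g idI')).
    by move=> y /NI' Iy; exists y => //; exists 0; rewrite mul0r addr0.
  move=> y; rewrite inE => /predU1P[->|yL].
    by exists 0 => //; exists 1; rewrite mul1r add0r.
  by exists y; [move=> J _ _; exact | exists 0; rewrite mul0r addr0].
have Ig : I g by apply: LI; exact: mem_head.
have [y0 Ny0 [z0 /I'P [z1 Iz1 [b ->]] cg]] := cI g Ig.
(* Solve [c * g = y0 + s * (z1 + b * g)] for [g]: its coefficient stays outside [P] because [s] is
   in [P]. *)
pose d := c - s * b.
have Pd : ~ P d by move=> h; apply: Pc; apply: (idealBK idP h); exact: idealMr.
have Idg : I' (d * g).
  have -> : d * g = y0 + s * z1 by rewrite mulrBl cg mulrDr addrA -mulrA addrK.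
  by apply: I'D; [exact: NI' | exact: I'M].
have dI x : I x -> I' (d * x).
  move=> /I'P[y Iy [e ->]]; rewrite mulrDr mulrCA; apply: I'D; first exact: I'M.
  exact: I'M.
have [|||||c' Pc' c'I'] := IHL I' (d * c) idI'.
- exact: prime_idealMn.
- by move=> J idJ NJ LJ x; apply.
- move=> x /I'I /cI[y Ny [z Iz E]]; exists (d * y); first exact: NM.
  by exists (d * z); [exact: dI | rewrite -mulrA E mulrDr mulrCA].
- by move=> x xL J _ _; exact.
- by [].
exists (c' * d); first exact: prime_idealMn.
by move=> x /dI /c'I'; rewrite mulrA.
Qed.

End Krull.

(** Suppose [s] is not in [Q] and [y] is a nonzero element of [Q]. The contracted powers of [y]
    stabilize modulo [s] in the local ring at [P], and Nakayama's lemma removes [s]. So [y ^+ k] is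
    a multiple of [y ^+ k.+1] in the local ring at [Q], and cancelling makes [y] a unit there,
    against [Q y]. *)
Lemma krull_principal_ideal (A : idomainType) (P Q : set A) (s : A) :
  noetherian A -> prime_ideal P -> P s ->
  (forall P', prime_ideal P' -> P' s -> P' `<=` P -> P' = P) ->
  prime_ideal Q -> Q `<=` P -> Q = P \/ Q = [set 0].
Proof.
move=> nA prP Ps minP prQ QP.
have [Qs|nQs] := pselect (Q s); first by left; exact: minP.
right; have [idP P1 _] := prP; have [idQ Q1 QM] := prQ.
apply/seteqP; split=> [y Qy /=|x ->]; last by case: idQ.
apply: contrapT => /eqP y0.
(* [I k] is the contraction of the ideal generated by [y ^+ k] in the local
   ring at Q *)
pose I k := [set a | exists2 d, ~ Q d & exists b, d * a = b * y ^+ k].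
have idI k : ideal (I k).
  split=> [|a a' [d Qd [b E]] [d' Qd' [b' E']]|e a [d Qd [b E]]].
  - by exists 1 => //; exists 0; rewrite mulr0 mul0r.
  - exists (d * d'); first exact: prime_idealMn.
    exists (d' * b + d * b').
    have -> : d * d' * (a + a') = d' * (d * a) + d * (d' * a') by ring.
    by rewrite E E'; ring.
  - by exists d => //; exists (e * b); rewrite mulrCA E mulrA.
have Idesc k : I k.+1 `<=` I k.
  by move=> a [d Qd [b E]]; exists d => //; exists (b * y); rewrite E exprS mulrA.
have Idiv k d a : ~ Q d -> I k (d * a) -> I k a.
  move=> Qd [e Qe [b E]]; exists (e * d); first exact: prime_idealMn.
  by exists b; rewrite -mulrA.
have [|k /(_ k (leqnn k)) [c Pc cJ]] :=
    minimal_prime_chain_stabilizes nA prP Ps minP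
      (J := fun k => [set x | exists2 y, I k y & exists b, x = y + b * s]).
  move=> k; split; first exact: idealD_principal.
    by move=> x [b ->]; exists 0; [case: (idI k) | exists b; rewrite add0r].
  by move=> x [z /Idesc Iz xE]; exists z.
have [L [LI genL]] := nA _ (idI k).
have [|c' Pc' c'I] := 
  nakayama prP Ps (idI k.+1) (idI k) Pc (fun J idJ _ => genL J idJ) _ LI (Idesc k).
  move=> x Ix; have [|z Iz [b E]] := cJ x.
    by exists x => //; exists 0; rewrite mul0r addr0.
  exists z => //; exists b; last by rewrite (mulrC s).
  (* Here [s] is outside [Q], so it can be divided out of an element of the contracted ideal. *)
  apply: (Idiv _ s) => //; have -> : s * b = c * x - z by rewrite E addrC addKr mulrC.
  by apply: idealB (idI k) _ (Idesc _ _ Iz); case: (idI k) => _ _; apply.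
have [] : I k.+1 (y ^+ k).
  apply: (Idiv _ c'); first by move/QP.
  by apply: c'I; exists 1 => //; exists 1.
move=> d Qd [b /eqP]; rewrite exprS mulrA (inj_eq (mulIf (expf_neq0 _ y0))).
by move=> /eqP dE; apply: Qd; rewrite dE; case: idQ => _ _; apply.
Qed.

(** * Hilbert's basis theorem *)

Section HilbertBasis.
Variable B : comNzRingType.
Implicit Types (I J : set {poly B}) (G : seq {poly B}).

(** Bounding the size, rather than fixing the degree to be [k], admits the coefficient 0 and makes
    this an ideal. *)
Definition lead_coefs J k : set B :=
  [set b | exists f, [/\ J f, (size f <= k.+1)%N & f`_k = b]].

Lemma ideal_lead_coefs J k : ideal J -> ideal (lead_coefs J k).
Proof.
move=> [J0 JD JM]; split=> /=.
- by exists 0; rewrite size_poly0 coef0.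
- move=> x y [f [Jf sf <-]] [g [Jg sg <-]]; exists (f + g).
  by rewrite coefD (leq_trans (size_polyD _ _)) ?geq_max ?sf ?sg //; split=> //; exact: JD.
- move=> a x [f [Jf sf <-]]; exists (a%:P * f); split; first exact: JM.
    by rewrite mul_polyC (leq_trans (size_scale_leq _ _)).
  by rewrite coefCM.
Qed.

Lemma lead_coefs_mono J j k : ideal J -> (j <= k)%N -> lead_coefs J j `<=` lead_coefs J k.
Proof.
move=> [_ _ JM] /subnK <- x [f [Jf sf <-]]; exists ('X^(k - j) * f); split.
- exact: JM.
- by rewrite (leq_trans (size_polyMleq _ _)) // size_polyXn addSn /= -addnS leq_add2l.
- by rewrite coefXnM ltnNge leq_addr /= addKn.
Qed.

(** Subtracting an element of [J] with the same top coefficient lowers the degree and stays in [I],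
    so induction on the size applies. *)
Lemma ideal_sub_lead_coefs I J : ideal I -> ideal J -> J `<=` I ->
  (forall k, lead_coefs I k `<=` lead_coefs J k) -> I `<=` J.
Proof.
move=> idI idJ JI IJ f; move: {2}(size f) (leqnn (size f)) => k.
elim: k f => [|k IHk] f sf If.
  by move: sf; rewrite leqn0 size_poly_eq0 => /eqP ->; case: idJ.
have [g [Jg sg fg]] : lead_coefs J k f`_k by apply: IJ; exists f.
apply: (idealBK idJ) (Jg); apply: IHk; last by apply: idealB => //; exact: JI.
apply/leq_sizeP => j; rewrite leq_eqVlt => /predU1P[<-|kj].
  by rewrite coefB fg subrr.
by rewrite coefB !nth_default ?subrr ?(leq_trans sf) ?(leq_trans sg).
Qed.

Lemma noetherian_poly : noetherian B -> noetherian {poly B}.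
Proof.
move=> nB I idI.
have fin (L : seq B) k : (forall x, x \in L -> exists2 j, (j <= k)%N & lead_coefs I j x) ->
    exists2 G : seq {poly B}, (forall g, g \in G -> I g) &
      forall J, ideal J -> (forall g, g \in G -> J g) -> forall x, x \in L -> lead_coefs J k x.
  elim: L => [|a L IHL] LI; first by exists [::].
  have [|G GI GL] := IHL; first by move=> x xL; apply: LI; rewrite inE xL orbT.
  have [j jk [f [If sf fj]]] := LI a (mem_head _ _).
  exists (f :: G) => [g|J idJ JfG x]; first by rewrite inE => /predU1P[->|/GI].
  have Jf : J f by apply: JfG; exact: mem_head.
  rewrite inE => /predU1P[->|]; last first.
    by apply: GL => // g gG; apply: JfG; rewrite inE gG orbT.
  by apply: (lead_coefs_mono idJ jk); exists f.
have idl : ideal (\bigcup_k lead_coefs I k).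
  split=> [|x y [j _ Ix] [k _ Iy]|a x [k _ Ix]].
  - by exists 0%N => //; case: (ideal_lead_coefs 0 idI).
  - exists (maxn j k) => //; case: (ideal_lead_coefs (maxn j k) idI) => _ + _; apply.
      exact: lead_coefs_mono idI (leq_maxl _ _) _ Ix.
    exact: lead_coefs_mono idI (leq_maxr _ _) _ Iy.
  - by exists k => //; case: (ideal_lead_coefs k idI) => _ _; apply.
have [L [LI genL]] := nB _ idl.
have [N LN] : exists N, forall x, x \in L -> exists2 j, (j <= N)%N & lead_coefs I j x.
  elim: L {genL} LI => [|a L IHL] LI; first by exists 0%N.
  have [|N LN] := IHL; first by move=> x xL; apply: LI; rewrite inE xL orbT.
  have [j _ Ia] := LI a (mem_head _ _).
  exists (maxn j N) => x; rewrite inE => /predU1P[->|/LN[i iN Ix]].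
    by exists j => //; exact: leq_maxl.
  by exists i => //; rewrite (leq_trans iN) // leq_maxr.
have [G0 G0I G0L] := fin _ _ LN.
have [G1 G1I G1L] : exists2 G : seq {poly B}, (forall g, g \in G -> I g) &
    forall J, ideal J -> (forall g, g \in G -> J g) ->
    forall k, (k < N)%N -> lead_coefs I k `<=` lead_coefs J k.
  elim: {LN G0L} N => [|N [G GI GL]]; first by exists [::] => [g|//]; rewrite in_nil.
  have [L' [L'I genL']] := nB _ (ideal_lead_coefs N idI).
  have [|G' G'I G'L] := fin L' N; first by move=> x /L'I; exists N.
  exists (G ++ G') => [g|J idJ GJ k]; first by rewrite mem_cat => /orP[/GI|/G'I].
  rewrite ltnS leq_eqVlt => /predU1P[->|]; last first.
    by apply: GL => // g gG; apply: GJ; rewrite mem_cat gG.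
  apply: genL'; first exact: ideal_lead_coefs.
  by apply: G'L => // g gG; apply: GJ; rewrite mem_cat gG orbT.
(* [G0] accounts for the leading coefficients in degrees from [N] on, [G1] for the finitely many
   degrees below [N]. *)
exists (G0 ++ G1); split=> [g|J idJ GJ]; first by rewrite mem_cat => /orP[/G0I|/G1I].
(* The comparison by leading coefficients wants an ideal inside [I], hence the intersection. *)
have idIJ : ideal (I `&` J).
  case: idI idJ => [I0 ID IM] [J0 JD JM]; split=> // [x y [Ix Jx] [Iy Jy]|a x [Ix Jx]].
    by split; [exact: ID | exact: JD].
  by split; [exact: IM | exact: JM].
suff : I `<=` I `&` J by move=> h x /h[].
apply: ideal_sub_lead_coefs => // k.
have [kN|Nk] := ltnP k N.
  apply: G1L => // g gG; split; first exact: G1I.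
  by apply: GJ; rewrite mem_cat gG orbT.
have h : \bigcup_k lead_coefs I k `<=` lead_coefs (I `&` J) k.
  apply: genL; first exact: ideal_lead_coefs.
  move=> x xL; apply: (lead_coefs_mono idIJ Nk); apply: G0L xL => // g gG.
  by split; [exact: G0I | apply: GJ; rewrite mem_cat gG].
by move=> x Ix; apply: h; exists k.
Qed.

End HilbertBasis.

(** * Transfer along ring morphisms, and polynomial rings over a field *)

Section Transfer.
Variables (A B : comNzRingType) (f : {rmorphism A -> B}).

Lemma ideal_preimage (I : set B) : ideal I -> ideal (f @^-1` I).
Proof.
move=> [I0 ID IM]; split=> /= [|x y|a x]; first by rewrite rmorph0.
  by rewrite rmorphD; exact: ID.
by rewrite rmorphM; exact: IM.
Qed.

Lemma prime_ideal_preimage (P : set B) : prime_ideal P -> prime_ideal (f @^-1` P).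
Proof.
move=> [idP P1 PM]; split; first exact: ideal_preimage.
  by rewrite /= rmorph1.
by move=> a b /=; rewrite rmorphM; exact: PM.
Qed.

Lemma noetherian_surj : (forall b, exists a, f a = b) -> noetherian A -> noetherian B.
Proof.
move=> fsurj nA I idI; have [L [LI genL]] := nA _ (ideal_preimage idI).
exists (map f L); split=> [x /mapP[a /LI Ia ->] //|J idJ LJ x].
have [a <-] := fsurj x; apply: genL (ideal_preimage idJ) _ a => a aL /=.
by apply: LJ; exact: map_f.
Qed.

End Transfer.

Lemma noetherian_field (K : fieldType) : noetherian K.
Proof.
move=> I idI; have [I0 ID IM] := idI.
have [[x [Ix /eqP x0]]|I00] := pselect (exists x, I x /\ x <> 0).
  exists [:: 1]; split=> [y|J [_ _ JM] J1 y _].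
    by rewrite inE => /eqP ->; rewrite -(mulVf x0); exact: IM.
  by rewrite -(mulr1 y); apply: JM; apply: J1; exact: mem_head.
exists [::]; split=> // J [J0 _ _] _ x Ix.
by have [->//|/eqP x0] := eqVneq x 0; case: I00; exists x.
Qed.

Section MpolyRec.
Variables (n : nat) (K : comNzRingType).

(** The indeterminate goes to the last variable. Surjectivity suffices to transport noetherianity
    and to pull primes back to univariate polynomials. *)
Definition mpoly_of_poly : {poly {mpoly K[n]}} -> {mpoly K[n.+1]} :=
  horner_morph (fun p : {mpoly K[n]} => mulrC ('X_ord_max : {mpoly K[n.+1]}) (mwiden p)).
HB.instance Definition _ := GRing.RMorphism.on mpoly_of_poly.

Lemma mpoly_of_polyC p : mpoly_of_poly p%:P = mwiden p.
Proof. exact: horner_morphC. Qed.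

Lemma mpoly_of_polyX : mpoly_of_poly 'X = 'X_ord_max.
Proof. exact: horner_morphX. Qed.

Lemma mpoly_of_poly_surj p : exists q, mpoly_of_poly q = p.
Proof.
elim/mpolyind: p => [|c m p _ _ [q <-]]; first by exists 0; rewrite rmorph0.
have [r rE] : exists r, mpoly_of_poly r = 'X_[m].
  exists ('X_[[multinom m (widen_ord (leqnSn n) i) | i < n]] *: 'X^(m ord_max)).
  rewrite -mul_polyC rmorphM rmorphXn /= mpoly_of_polyC mpoly_of_polyX.
  rewrite [RHS]mpolyXE_id big_ord_recr mwidenX [in LHS]mpolyXE_id big_ord_recr /=.
  rewrite mnmwiden_ordmax expr0 mulr1; congr (_ * _).
  by apply: eq_bigr => i _; rewrite mnmwiden_widen mnmE.
exists (c%:MP%:P * r + q); rewrite rmorphD rmorphM /= rE; congr (_ + _).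
rewrite -mul_mpolyC; congr (_ * _).
by rewrite mpoly_of_polyC mwidenC.
Qed.
End MpolyRec.

Lemma noetherian_mpoly (n : nat) (K : fieldType) : noetherian {mpoly K[n]}.
Proof.
elim: n => [|n IHn].
  apply: (@noetherian_surj _ _ (@mpolyC 0 K)) (@noetherian_field K) => p.
  by exists p@_0%MM; exact/esym/nvar0_mpolyC.
by apply: (@noetherian_surj _ _ (@mpoly_of_poly n K)) (noetherian_poly IHn) => p;
   exact: mpoly_of_poly_surj.
Qed.

(** * The Nullstellensatz *)

Lemma ex_min_measure (T : Type) (P : T -> Prop) (m : T -> nat) :
  (exists x, P x) -> exists2 x, P x & forall y, P y -> (m x <= m y)%N.
Proof.
case=> x Px; have exk : exists k, `[< exists2 y, P y & m y = k >].
  by exists (m x); apply/asboolP; exists x.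
case: (ex_minnP exk) => k /asboolP[y Py <-] kmin.
by exists y => // z Pz; apply: kmin; apply/asboolP; exists z.
Qed.

Lemma pseudo_division (B : idomainType) (p q : {poly B}) : q != 0 ->
  exists k u r, lead_coef q ^+ k *: p = u * q + r /\ (size r < size q)%N.
Proof.
move=> q0; exists (scalp p q), (p %/ q), (p %% q).
by rewrite -Pdiv.Idomain.divp_eq ltn_modp.
Qed.

Section PrimeExtension.
Variables (B : idomainType) (K : closedFieldType).
Variables (T : Type) (chi : T -> {rmorphism B -> K}).
Variable Q : set {poly B}.
Hypothesis prQ : prime_ideal Q.

(** Membership in the extension to B[x] of the contraction of [Q] to [B]. *)
Let coefs_in (g : {poly B}) := forall i, Q (g`_i)%:P.

Let coefs_in_sub g : coefs_in g -> Q g.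
Proof.
move=> gQ; have [[Q0 QD QM] _ _] := prQ.
rewrite -[g]coefK poly_def; elim/big_ind: _ => // i _.
by rewrite -mul_polyC mulrC; exact: QM.
Qed.

Let drop_lead (g : {poly B}) := g - (lead_coef g)%:P * 'X^((size g).-1).

Let size_drop_lead g : g != 0 -> (size (drop_lead g) < size g)%N.
Proof.
move=> g0; have sg : (0 < size g)%N by rewrite size_poly_gt0.
rewrite -[X in (_ < X)%N](prednK sg) ltnS; apply/leq_sizeP => j.
rewrite coefB coefCM coefXn leq_eqVlt => /predU1P[<-|sj].
  by rewrite eqxx mulr1 subrr.
by rewrite gtn_eqF // mulr0 subr0 nth_default // -(prednK sg).
Qed.

(** The Nullstellensatz for the contraction of [Q] to [B], as the induction will supply it. *)
Hypothesis specialize : forall b, ~ Q b%:P ->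
  exists t, (forall a, Q a%:P -> chi t a = 0) /\ chi t b != 0.

(** If [Q] is not extended from [B], an element [p] of least degree outside the extended ideal
    generates [Q] over the fraction field of [B] modulo the contraction, and [f] is invertible
    modulo [p]. Clearing denominators, some multiple of [f] is a constant modulo [Q]; a
    specialization that keeps this constant and the leading coefficient of [p] nonzero allows any
    root of [p] to be chosen. *)
Lemma poly_specialize f : ~ Q f ->
  exists t x, (forall g, Q g -> (map_poly (chi t) g).[x] = 0) /\
              (map_poly (chi t) f).[x] != 0.
Proof.
move=> Qf; have [idQ Q1 QM] := prQ; have [Q0 QaD QaM] := idQ.
have map0 t g : (forall a, Q a%:P -> chi t a = 0) -> coefs_in g ->
    map_poly (chi t) g = 0.
  by move=> ht gQ; apply/polyP => i; rewrite coef_map coef0 /= ht.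
have [allQ|/existsNP[p0 /not_implyP[Qp0 cp0]]] :=
    pselect (forall g, Q g -> coefs_in g).
  have [b Qb] : exists i, ~ Q (f`_i)%:P.
    apply: contrapT => /forallNP h; apply: Qf; apply: coefs_in_sub => i.
    exact: contrapT (h i).
  have [t [ht tb]] := specialize Qb.
  have /closed_nonrootP[x fx] : map_poly (chi t) f != 0.
    apply: contraNneq tb => /(congr1 (fun g : {poly K} => g`_b)).
    by rewrite coef_map coef0 => ->.
  by exists t, x; split=> // g /allQ gQ; rewrite map0 // horner0.
have [p [Qp cp] pmin] : exists2 p, Q p /\ ~ coefs_in p &
    forall g, Q g /\ ~ coefs_in g -> (size p <= size g)%N.
  by apply: (ex_min_measure (P := fun g => Q g /\ ~ coefs_in g)); exists p0.
have small g : Q g -> (size g < size p)%N -> coefs_in g.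
  by move=> Qg; apply: contraPP => cg; rewrite ltnNge pmin.
have p_neq0 : p != 0.
  by apply/eqP => p0'; apply: cp => i; rewrite p0' coef0.
have Qlp : ~ Q (lead_coef p)%:P.
  move=> Ql; apply: cp => i.
  have cd : coefs_in (drop_lead p).
    by apply: small; [apply: idealB => //; exact: idealMr | exact: size_drop_lead].
  rewrite -[p](subrK ((lead_coef p)%:P * 'X^((size p).-1))) coefD polyCD.
  by apply: QaD; [exact: cd | rewrite coefCM polyCM; exact: idealMr].
have size_p : (1 < size p)%N.
  rewrite ltnNge; apply/negP => /size1_polyC pE.
  by apply: Qlp; rewrite pE lead_coefC -pE.
(* [h] is a multiple of [f] modulo [Q], of least size outside [Q]; it will turn out to be
   constant. *)
have [h [Qh [u Quh]] hmin] : exists2 h, ~ Q h /\ (exists u, Q (h - u * f)) &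
    forall g, ~ Q g /\ (exists u, Q (g - u * f)) -> (size h <= size g)%N.
  apply: (ex_min_measure (P := fun h => ~ Q h /\ (exists u, Q (h - u * f)))).
  by exists f; split=> //; exists 1; rewrite mul1r subrr.
have h_neq0 : h != 0 by apply/eqP => h0; apply: Qh; rewrite h0.
have Qlh : ~ Q (lead_coef h)%:P.
  move=> Ql; have := size_drop_lead h_neq0; rewrite ltnNge => /negP; apply.
  have Qd : Q ((lead_coef h)%:P * 'X^((size h).-1)) by exact: idealMr.
  apply: hmin; split; first by move=> Qdh; apply: Qh; exact: idealBK Qdh Qd.
  by exists u; rewrite /drop_lead addrAC; exact: idealB.
have size_hp : (size h < size p)%N.
  rewrite ltnNge; apply/negP => ph.
  have [k [q [r [E sr]]]] := pseudo_division h p_neq0.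
  have : (size h <= size r)%N.
    have rE : r = lead_coef p ^+ k *: h - q * p by rewrite E addrC addKr.
    apply: hmin; split.
      move=> Qr; have : Q ((lead_coef p)%:P ^+ k * h).
        by rewrite -polyC_exp mul_polyC E; apply: QaD => //; exact: QaM.
      by case/QM => //; exact: prime_idealX.
    exists ((lead_coef p ^+ k)%:P * u); rewrite rE -mul_polyC.
    have -> : (lead_coef p ^+ k)%:P * h - q * p - (lead_coef p ^+ k)%:P * u * f =
      (lead_coef p ^+ k)%:P * (h - u * f) - q * p by ring.
    by apply: idealB => //; exact: QaM.
  by rewrite leqNgt (leq_trans sr).
(* Otherwise divide [p] by [h]. The remainder is in [Q] by minimality of [h], hence so is the
   quotient [q]. As [q] is shorter than [p], its coefficients are in [Q], and then so is the leading
   coefficient of [q * h], a power of that of [h] times that of [p]. *)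
have size_h : (size h <= 1)%N.
  rewrite leqNgt; apply/negP => h1.
  have [k [q [r [E sr]]]] := pseudo_division p h_neq0.
  have Qr : Q r.
    apply: contrapT => Qr; have : (size h <= size r)%N.
      apply: hmin; split=> //; exists (- q * u).
      have -> : r - - q * u * f = (lead_coef h ^+ k)%:P * p - q * (h - u * f).
        by rewrite mul_polyC E; ring.
      by apply: idealB => //; exact: QaM.
    by rewrite leqNgt sr.
  have Qq : Q q.
    have : Q (q * h).
      by rewrite -[q * h](addrK r) -E -mul_polyC; apply: idealB => //; exact: QaM.
    by case/QM.
  have lk0 : lead_coef h ^+ k != 0 by rewrite expf_neq0 // lead_coef_eq0.
  have slkr : (size (- r) < size (lead_coef h ^+ k *: p))%N.
    by rewrite size_polyN size_scale // (ltn_trans sr).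
  have qhE : q * h = lead_coef h ^+ k *: p - r by rewrite E addrK.
  have sqh : size (q * h) = size p by rewrite qhE size_polyDl // size_scale.
  have q_neq0 : q != 0.
    by apply: contraTneq size_p => q0; rewrite -sqh q0 mul0r size_poly0.
  have cq : coefs_in q.
    apply: small => //; rewrite -sqh size_mul //; move: h1.
    by case: (size h) => [//|[//|m _]]; rewrite addnS /= addnS ltnS leq_addr.
  have : Q (lead_coef h ^+ k * lead_coef p)%:P.
    rewrite -lead_coefZ -(lead_coefDl slkr) -qhE lead_coefM polyCM.
    by apply: idealMr => //; exact: cq.
  by rewrite polyCM polyC_exp => /QM[] //; exact: prime_idealX.
have hE : h = (h`_0)%:P by exact: size1_polyC.
(* The factor [lead_coef p] preserves the degree of [p], so that a root exists; the other factor
   keeps [f] from vanishing there. *)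
have [|t [ht]] := @specialize (h`_0 * lead_coef p).
  by rewrite polyCM -hE; exact: prime_idealMn.
rewrite rmorphM mulf_eq0 negb_or => /andP[ha hp].
have /closed_rootP[x /rootP px] : size (map_poly (chi t) p) != 1%N.
  by rewrite size_map_poly_id0 // gtn_eqF.
(* The remainder of [g] by [p] is in [Q] and shorter than [p], so all its coefficients specialize to
   0. *)
have vanish g : Q g -> (map_poly (chi t) g).[x] = 0.
  move=> Qg; have [k [q [r [E sr]]]] := pseudo_division g p_neq0.
  have r0 : map_poly (chi t) r = 0.
    apply: map0 => //; apply: small => //.
    have -> : r = (lead_coef p ^+ k)%:P * g - q * p by rewrite mul_polyC E addrC addKr.
    by apply: idealB => //; exact: QaM.
  move: (congr1 (fun g => (map_poly (chi t) g).[x]) E).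
  rewrite -mul_polyC rmorphD !rmorphM /= map_polyC r0 addr0 !hornerM px mulr0.
  rewrite hornerC /= rmorphXn => /eqP; rewrite mulf_eq0 expf_eq0 (negPf hp) andbF /=.
  by move/eqP.
exists t, x; split=> //; apply: contraNneq ha => fx.
have := vanish _ Quh; rewrite rmorphB rmorphM hornerD hornerN hornerM fx mulr0 subr0.
by rewrite hE /= (map_polyC (chi t)) hornerC coefC eqxx => ->.
Qed.

End PrimeExtension.

Definition extend_point n (K : Type) (v : 'I_n -> K) (x : K) (i : 'I_n.+1) : K :=
  oapp v x (unlift ord_max i).

Lemma meval_mwiden n (K : comNzRingType) (v : 'I_n -> K) x (p : {mpoly K[n]}) :
  (mwiden p).@[extend_point v x] = p.@[v].
Proof.
rewrite [p]mpolyE (raddf_sum (@mwiden n K)) !raddf_sum /=; apply: eq_bigr => m _.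
rewrite mwidenZ !mevalZ mwidenX !mevalX big_ord_recr /= mnmwiden_ordmax expr0 mulr1.
congr (_ * _); apply: eq_bigr => i _; rewrite mnmwiden_widen /extend_point.
have -> : widen_ord (leqnSn n) i = fintype.lift ord_max i.
  by apply/val_inj; rewrite /= /bump leqNgt ltn_ord add0n.
by rewrite liftK.
Qed.

(* The induction on the number of variables needs no change of coordinates:
   a prime of B[x] either is extended from B, or contains a polynomial whose
   roots specialize it. *)
Theorem nullstellensatz (n : nat) (K : closedFieldType) (Q : set {mpoly K[n]})
    (f : {mpoly K[n]}) :
  prime_ideal Q -> ~ Q f ->
  exists v : 'I_n -> K, (forall g, Q g -> g.@[v] = 0) /\ f.@[v] != 0.
Proof.
elim: n Q f => [|n IHn] Q f prQ Qf.
  have [[Q0 QD QM] Q1 _] := prQ.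
  have Q_eq0 g : Q g -> g = 0.
    rewrite [g]nvar0_mpolyC; have [->|g0] := eqVneq g@_0%MM 0; first by rewrite mpolyC0.
    move=> Qg; case: Q1; rewrite -mpolyC1 -(mulVf g0) mpolyCM.
    exact: QM.
  exists (fun=> 0); split=> [g /Q_eq0 ->|]; first by rewrite meval0.
  have : f != 0 by apply/eqP => f0; apply: Qf; rewrite f0.
  by apply: contra_neq; rewrite {1 2}[f]nvar0_mpolyC mevalC => ->; rewrite mpolyC0.
have [f' fE] := mpoly_of_poly_surj f.
have [||v [x [vx fx]]] := @poly_specialize {mpoly K[n]} K ('I_n -> K)
  (fun v => [the {rmorphism _ -> _} of meval v]) _
  (prime_ideal_preimage (@mpoly_of_poly n K) prQ) _ f'.
- move=> b /= Qb; rewrite mpoly_of_polyC in Qb.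
  have [v [vx vb]] := IHn _ b (prime_ideal_preimage (@mwiden n K) prQ) Qb.
  by exists v; split=> // a Qa; apply: vx; rewrite /= -mpoly_of_polyC.
- by rewrite /= fE.
have evalE g : (mpoly_of_poly g).@[extend_point v x] =
    (map_poly (meval v) g).[x].
  elim/poly_ind: g => [|g c IHg]; first by rewrite !rmorph0 horner0.
  rewrite !rmorphD !rmorphM /= mpoly_of_polyC mpoly_of_polyX map_polyC map_polyX.
  rewrite mevalXU IHg !hornerE /extend_point unlift_none /=; congr (_ + _).
  exact: meval_mwiden.
exists (extend_point v x); split=> [g Qg|].
  by have [g' gE] := mpoly_of_poly_surj g; rewrite -gE evalE vx //= gE.
by rewrite -fE evalE.
Qed.

(** * Irreducible closed sets *)

Section Irreducible.
Variable T : topologicalType.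
Implicit Types Y Z : set T.

(** Codimension one in an irreducible space, in a form that passes to open subsets and to the orbit
    space without handling chains. *)
Definition irreducible_coatom Y : Prop :=
  Y <> setT /\ forall Z, irreducible_closed Z -> Y `<=` Z -> Z = Y \/ Z = setT.

Lemma coatom_integral_divisor Y :
  irreducible_closed [set: T] -> irreducible_closed Y -> irreducible_coatom Y ->
  integral_divisor Y.
Proof.
move=> irT irY [YT coY]; split=> //; split.
  exists (fun i => if i is 0%N then Y else setT); split=> // [[|i] //|[|i] // _].
  by split=> // h; apply: YT; apply/seteqP.
move=> [|[|m]] // [c [c0 irc ltc]].
have [c01 nc10] := ltc 0%N isT; have [c12 nc21] := ltc 1%N isT.
rewrite c0 in c01 nc10; case: (coY _ (irc 1%N isT) c01) => c1.
  by case: nc10; rewrite c1.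
by case: nc21; rewrite c1.
Qed.

Lemma integral_divisor_neqT Y : integral_divisor Y -> Y <> setT.
Proof.
move=> [_ [[c [c0 _ ltc]] _]] YT; have [_] := ltc 0%N isT.
by rewrite c0 YT; apply.
Qed.

Lemma closed_seqU (L : seq (set T)) : (forall Y, Y \in L -> closed Y) ->
  closed [set x | exists2 Y, Y \in L & Y x].
Proof.
elim: L => [|Y L IHL] cL.
  by rewrite (_ : [set _ | _] = set0); [exact: closed0 | apply/seteqP; split=> // x [V]].
rewrite (_ : [set _ | _] = Y `|` [set x | exists2 V, V \in L & V x]); last first.
  apply/seteqP; split=> x.
    by move=> [V]; rewrite inE => /predU1P[->|VL] Vx; [left|right; exists V].
  move=> [Yx|[V VL Vx]]; first by exists Y => //; exact: mem_head.
  by exists V => //; rewrite inE VL orbT.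
apply: closedU; first by apply: cL; exact: mem_head.
by apply: IHL => V VL; apply: cL; rewrite inE VL orbT.
Qed.

Lemma irreducible_sub_seq Z (L : seq (set T)) :
  irreducible_closed Z -> (forall Y, Y \in L -> closed Y) ->
  (forall x, Z x -> exists2 Y, Y \in L & Y x) -> exists2 Y, Y \in L & Z `<=` Y.
Proof.
move=> [_ [z Zz] irZ]; elim: L => [|Y L IHL] cL ZL; first by have [] := ZL z Zz.
have cL' V : V \in L -> closed V by move=> VL; apply: cL; rewrite inE VL orbT.
have [|||ZY|ZL'] := irZ Y [set x | exists2 Y, Y \in L & Y x].
- by apply: cL; exact: mem_head.
- exact: closed_seqU.
- move=> x /ZL[V]; rewrite inE => /predU1P[->|VL] Vx; first by left.
  by right; exists V.
- by exists Y => //; exact: mem_head.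
- have [V VL ZV] := IHL cL' ZL'; exists V => //; by rewrite inE VL orbT.
Qed.

End Irreducible.

Lemma closure_min (T : topologicalType) (A C : set T) :
  closed C -> A `<=` C -> closure A `<=` C.
Proof. by move=> cC /closureS AC; apply: subset_trans cC. Qed.

Section OpenSubspace.
Variables (T : topologicalType) (U : set T).
Implicit Types (Y : set U) (Z : set T).

Lemma closed_subspaceP Y : closed Y <-> exists2 Z, closed Z & Y = set_val @^-1` Z.
Proof.
split=> [/closed_openC[V oV VY]|[Z cZ ->]].
  by exists (~` V); [exact: open_closedC | rewrite -[Y]setCK -VY].
rewrite -openC; exists (~` Z) => //; exact: closed_openC.
Qed.

Lemma preimage_closure Y : closed Y -> set_val @^-1` closure (set_val @` Y) = Y.
Proof.
move=> /closed_subspaceP[Z cZ ->]; apply/seteqP; split=> [x|x Zx].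
  by apply: closure_min cZ _ _ => _ [y Zy <-].
by apply: subset_closure; exists x.
Qed.

Lemma irreducible_closure Y :
  irreducible_closed Y -> irreducible_closed (closure (set_val @` Y)).
Proof.
move=> [cY [y Yy] irY]; split; first exact: closed_closure.
  by exists (set_val y); apply: subset_closure; exists y.
move=> B C cB cC YBC.
have sub A : closed A -> Y `<=` set_val @^-1` A -> closure (set_val @` Y) `<=` A.
  by move=> cA YA; apply: closure_min => // _ [x Yx <-]; exact: YA.
have [|||YB|YC] := irY (set_val @^-1` B) (set_val @^-1` C).
- by apply/closed_subspaceP; exists B.
- by apply/closed_subspaceP; exists C.
- by move=> x Yx; apply: YBC; apply: subset_closure; exists x.
- by left; exact: sub.
- by right; exact: sub.
Qed.

Hypothesis oU : open U.

(** [Z] is covered by the closure of its trace on [U] and by the complement of [U], and is not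
    contained in the latter. *)
Lemma closure_preimage Z : irreducible_closed Z -> Z `&` U !=set0 ->
  closure (set_val @` (set_val @^-1` Z : set U)) = Z.
Proof.
move=> [cZ _ irZ] [z [Zz Uz]]; apply/seteqP; split.
  by apply: closure_min => // _ [x Zx <-].
have [|||//|/(_ _ Zz) //] := irZ (closure (set_val @` (set_val @^-1` Z : set U))) (~` U).
- exact: closed_closure.
- exact: open_closedC.
- move=> x Zx; have [Ux|] := pselect (U x); last by right.
  by left; apply: subset_closure; exists (exist _ x (mem_set Ux)).
Qed.

Lemma irreducible_preimage Z : irreducible_closed Z -> Z `&` U !=set0 ->
  irreducible_closed (set_val @^-1` Z : set U).
Proof.
move=> irZ ZU; have [cZ _ IZ] := irZ; split.
- by apply/closed_subspaceP; exists Z.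
- by have [z [Zz Uz]] := ZU; exists (exist _ z (mem_set Uz)).
move=> _ _ /closed_subspaceP[B cB ->] /closed_subspaceP[C cC ->] ZBC.
have /IZ : Z `<=` B `|` C.
  rewrite -(closure_preimage irZ ZU); apply: closure_min => [|_ [x Zx <-]].
    exact: closedU.
  exact: ZBC.
by move=> /(_ cB cC) [ZB|ZC]; [left=> x /ZB | right=> x /ZC].
Qed.

Lemma coatom_preimage Z :
  irreducible_closed [set: T] -> irreducible_closed Z -> Z `&` U !=set0 ->
  irreducible_coatom Z -> irreducible_coatom (set_val @^-1` Z : set U).
Proof.
move=> irT irZ ZU [ZT coZ]; have [cZ _ IZ] := irZ; split=> [UT|Y irY ZY].
  have UZ : U `<=` Z.
    by move=> x Ux; have : [set: U] (exist _ x (mem_set Ux)) by []; rewrite -UT.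
  have [_ _ /(_ Z (~` U) cZ (open_closedC oU))[]] := irT.
  - by move=> x _; have [/UZ|] := pselect (U x); [left|right].
  - by move=> TZ; apply: ZT; apply/seteqP; split.
  - by have [z [_ Uz]] := ZU => /(_ z Logic.I).
have [cY _ _] := irY.
have ZcY : Z `<=` closure (set_val @` Y).
  by rewrite -(closure_preimage irZ ZU); apply: closureS; exact: image_subset.
rewrite -(preimage_closure cY).
by have [->|->] := coZ _ (irreducible_closure irY) ZcY; [left|right].
Qed.

End OpenSubspace.

(** * Closed sets of the hypersurface *)

Section ZerosVanishing.
Variables (n : nat) (K : closedFieldType) (F : {mpoly K[n]}).
Implicit Types (S P Q : set {mpoly K[n]}) (Z Y : set (hypersurface F)).

Definition zeros S : set (hypersurface F) :=
  [set x | forall p, S p -> mev p (set_val x) = 0].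

Definition vanishing Z : set {mpoly K[n]} :=
  [set p | forall x, Z x -> mev p (set_val x) = 0].

Lemma mev0 (x : affine n K) : mev 0 x = 0. Proof. exact: meval0. Qed.
Lemma mevD p q (x : affine n K) : mev (p + q) x = mev p x + mev q x.
Proof. exact: mevalD. Qed.
Lemma mevM p q (x : affine n K) : mev (p * q) x = mev p x * mev q x.
Proof. exact: mevalM. Qed.

Lemma mev_hypersurface (x : hypersurface F) : mev F (set_val x) = 0.
Proof. exact: (set_valP x). Qed.

Lemma closed_zeros S : closed (zeros S).
Proof.
apply/closed_subspaceP; exists (zero_locus S) => //.
by rewrite -[zero_locus S]setCK; apply: open_closedC; exists S; rewrite setCK.
Qed.

Lemma closed_zerosP Z : closed Z -> exists S, Z = zeros S.
Proof.
move=> /closed_subspaceP[V /closed_openC[S VS] ->].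
by exists S; rewrite -[V]setCK VS.
Qed.

Lemma zerosK Z : closed Z -> zeros (vanishing Z) = Z.
Proof.
move=> /closed_zerosP[S ->]; apply/seteqP; split=> [x Zx p Sp|x Zx p]; last exact.
by apply: Zx => y; exact.
Qed.

Lemma vanishingS Y Z : Y `<=` Z -> vanishing Z `<=` vanishing Y.
Proof. by move=> YZ p Zp x /YZ; exact: Zp. Qed.

Lemma zerosS P Q : P `<=` Q -> zeros Q `<=` zeros P.
Proof. by move=> PQ x Qx p /PQ; exact: Qx. Qed.

Lemma vanishing_F Z : vanishing Z F.
Proof. by move=> x _; exact: mev_hypersurface. Qed.

Lemma ideal_vanishing Z : ideal (vanishing Z).
Proof.
split=> [x _|p q Zp Zq x Zx|p q Zq x Zx]; first exact: mev0.
  by rewrite mevD Zp // Zq // addr0.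
by rewrite mevM Zq // mulr0.
Qed.

Lemma prime_vanishing Z : irreducible_closed Z -> prime_ideal (vanishing Z).
Proof.
move=> [cZ [x Zx] irZ]; split; first exact: ideal_vanishing.
  by move=> /(_ x Zx) /eqP; rewrite /mev meval1 oner_eq0.
move=> p q Zpq; have [|||Zp|Zq] := irZ (zeros [set p]) (zeros [set q]).
- exact: closed_zeros.
- exact: closed_zeros.
- move=> y Zy; have /eqP := Zpq y Zy; rewrite mevM mulf_eq0 => /orP[/eqP yp|/eqP yq].
    by left=> _ ->.
  by right=> _ ->.
- by left=> y /Zp; exact.
- by right=> y /Zq; exact.
Qed.

(** The point supplied by the Nullstellensatz lies on X because [P] contains [F]. *)
Lemma vanishing_zeros P : prime_ideal P -> P F -> vanishing (zeros P) = P.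
Proof.
move=> prP PF; apply/seteqP; split=> [f Zf|f Pf x]; last exact.
apply: contrapT => /(nullstellensatz prP)[v [vP fv]].
pose x : affine n K := \row_i v i.
have mevE p : mev p x = p.@[v] by apply: meval_eq => i; rewrite mxE.
have Fx : x \in hypersurface F by apply/mem_set; rewrite /hypersurface /= mevE; exact: vP.
have /eqP := Zf (exist _ x Fx) (fun p Pp => etrans (mevE p) (vP p Pp)).
by apply/negP; rewrite set_valE /= mevE.
Qed.

Lemma irreducible_zeros P : prime_ideal P -> P F -> irreducible_closed (zeros P).
Proof.
move=> prP PF; have [idP P1 PM] := prP; split; first exact: closed_zeros.
  apply: contrapT => /set0P/negP/negPn/eqP Z0; apply: P1.
  by rewrite -(vanishing_zeros prP PF) Z0.
move=> _ _ /closed_zerosP[S ->] /closed_zerosP[T ->] PST.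
apply: contrapT => /not_orP[/existsNP[x /not_implyP[Px /existsNP[p /not_implyP[Sp px]]]]].
move=> /existsNP[y /not_implyP[Py /existsNP[q /not_implyP[Tq qy]]]].
have : P (p * q).
  rewrite -(vanishing_zeros prP PF) => z /PST[/(_ _ Sp)|/(_ _ Tq)] e.
    by rewrite mevM e mul0r.
  by rewrite mevM e mulr0.
by case/PM => h; [apply: px; exact: Px | apply: qy; exact: Py].
Qed.

(* A decomposition of minimal length has no inclusions among its members. *)
Lemma irreducible_decomposition Z : closed Z ->
  exists2 L : seq (set (hypersurface F)),
    (forall x, Z x <-> exists2 Y, Y \in L & Y x) &
    forall Y, Y \in L -> irreducible_closed Y /\
      forall W, irreducible_closed W -> Y `<=` W -> W `<=` Z -> W = Y.
Proof.
pose decomp Z (L : seq (set (hypersurface F))) :=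
  (forall x, Z x <-> exists2 Y, Y \in L & Y x) /\
  (forall Y, Y \in L -> irreducible_closed Y).
move=> cZ.
have [L dL] : exists L, decomp Z L.
  apply: contrapT => noL.
  have [] := @noetherian_max {mpoly K[n]}
    [set I | exists W, [/\ closed W, I = vanishing W & ~ exists L, decomp W L]]
    (@noetherian_mpoly n K).
  - by move=> _ [W [_ -> _]]; exact: ideal_vanishing.
  - by exists (vanishing Z), Z.
  move=> _ [W [cW -> noW]] maxW.
  (* Noetherian induction: [W] has a maximal vanishing ideal among the closed sets without
     decomposition, so its proper closed subsets decompose. *)
  have smaller B : closed B -> ~ (W `<=` B) -> exists L, decomp (W `&` B) L.
    move=> cB WB; apply: contrapT => noWB; apply: WB.
    have : vanishing (W `&` B) = vanishing W.
      apply: maxW; first by exists (W `&` B); split=> //; exact: closedI.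
      exact: vanishingS.
    move=> /(congr1 zeros); rewrite !zerosK //; last exact: closedI.
    by move=> <- x [].
  have [Wx|W0] := pselect (W !=set0); last first.
    apply: noW; exists [::]; split=> // x; split=> [Wx|[Y]//].
    by case: W0; exists x.
  have [irW|] := pselect (forall B C, closed B -> closed C -> W `<=` B `|` C ->
      W `<=` B \/ W `<=` C).
    apply: noW; exists [:: W]; split=> [x|Y]; last by rewrite inE => /eqP ->.
    split=> [Wx'|[Y]]; first by exists W => //; exact: mem_head.
    by rewrite inE => /eqP ->.
  move=> /existsNP[B /existsNP[C /not_implyP[cB /not_implyP[cC /not_implyP[WBC]]]]].
  move=> /not_orP[WB WC].
  have [L1 [L1E irL1]] := smaller _ cB WB; have [L2 [L2E irL2]] := smaller _ cC WC.
  apply: noW; exists (L1 ++ L2); split=> [x|Y]; last by rewrite mem_cat => /orP[/irL1|/irL2].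
  split=> [Wx'|[Y]].
    have [Bx|Cx] := WBC x Wx'.
      by have /L1E[Y YL Yx] : (W `&` B) x by []; exists Y => //; rewrite mem_cat YL.
    by have /L2E[Y YL Yx] : (W `&` C) x by []; exists Y => //; rewrite mem_cat YL orbT.
  rewrite mem_cat => /orP[YL|YL] Yx.
    by have [] : (W `&` B) x by apply/L1E; exists Y.
  by have [] : (W `&` C) x by apply/L2E; exists Y.
have [{dL}L [LE irL] Lmin] := ex_min_measure (P := decomp Z) size (ex_intro _ L dL).
exists L => // Y YL; split=> [|W irW YW WZ]; first exact: irL.
have [Y' Y'L WY'] : exists2 Y', Y' \in L & W `<=` Y'.
  apply: irreducible_sub_seq irW _ _ => [Y' /irL[]//|x /WZ]; exact: (iffLR (LE x)).
have YY' : Y `<=` Y' by exact: subset_trans WY'.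
have [Y'E|Y'nY] := eqVneq Y' Y; first by apply/seteqP; rewrite -{1}Y'E.
(* [Y] lies in another member [Y'], so dropping it still leaves a decomposition, which is
   shorter. *)
have : (size L <= size [seq V <- L | V != Y])%N.
  apply: Lmin; split=> [x|V]; last by rewrite mem_filter => /andP[_ /irL].
  rewrite LE; split=> [[V VL Vx]|[V]]; last first.
    by rewrite mem_filter => /andP[_ VL] Vx; exists V.
  have [VY|VY] := eqVneq V Y; last by exists V => //; rewrite mem_filter VY.
  by exists Y'; [rewrite mem_filter Y'nY | apply: YY'; rewrite -VY].
rewrite size_filter -(count_predC (fun V => V != Y) L) -[X in (_ <= X)%N]addn0.
rewrite leq_add2l leqn0 => /eqP c0.
suff : has (predC (fun V => V != Y)) L by rewrite has_count c0.
by apply/hasP; exists Y => //=; rewrite negbK.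
Qed.

End ZerosVanishing.

(** * Primes of the coordinate ring and codimension of components *)

Section PrimeImage.
Variables (A B : comNzRingType) (f : {rmorphism A -> B}) (P : set A).
Hypotheses (f_surj : forall b, exists a, f a = b) (prP : prime_ideal P).
Hypothesis kerP : forall a, f a = 0 -> P a.

Lemma image_prime_idealE a : (f @` P) (f a) <-> P a.
Proof.
split=> [[b Pb fE]|Pa]; last by exists a.
have [idP _ _] := prP; apply: idealBK idP _ Pb.
by apply: kerP; rewrite rmorphB fE subrr.
Qed.

Lemma prime_ideal_image : prime_ideal (f @` P).
Proof.
have [[P0 PD PM] P1 PMn] := prP; split.
- split=> [|_ _ [a Pa <-] [b Pb <-]|c _ [a Pa <-]].
  + by exists 0; rewrite ?rmorph0.
  + by exists (a + b); rewrite ?rmorphD //; exact: PD.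
  + have [d <-] := f_surj c; exists (d * a); first exact: PM.
    by rewrite rmorphM.
- by rewrite -(rmorph1 f) image_prime_idealE.
- move=> b c; have [a <-] := f_surj b; have [d <-] := f_surj c.
  by rewrite -rmorphM !image_prime_idealE; exact: PMn.
Qed.

End PrimeImage.

Section Codimension.
Variables (n : nat) (K : closedFieldType) (F : {mpoly K[n]}).
Variables (A : idomainType) (phi : {rmorphism {mpoly K[n]} -> A}).
Hypothesis phiP : is_coordinate_ring F phi.
Implicit Types (Y Z : set (hypersurface F)).

Let phi_surj : forall a, exists p, phi p = a := phiP.1.

Lemma prime_zero_ideal (B : idomainType) : prime_ideal [set 0 : B].
Proof.
split=> [|/eqP|a b /eqP]; last 1 first.
- by rewrite mulf_eq0 => /orP[/eqP|/eqP]; [left|right].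
- split=> // [_ _ -> ->|c _ ->]; first exact: addr0.
  exact: mulr0.
- by rewrite oner_eq0.
Qed.

Lemma vanishing_setT : vanishing [set: hypersurface F] = phi @^-1` [set 0].
Proof.
have prF := prime_ideal_preimage phi (prime_zero_ideal A).
have zF : zeros (phi @^-1` [set 0]) = [set: hypersurface F].
  apply/seteqP; split=> // x _ p /phiP.2[q ->].
  by rewrite mevM mev_hypersurface mulr0.
by rewrite -zF vanishing_zeros //; apply/phiP.2; exists 1; rewrite mul1r.
Qed.

Lemma irreducible_hypersurface : irreducible_closed [set: hypersurface F].
Proof.
rewrite -(zerosK closedT); apply: irreducible_zeros (@vanishing_F _ _ _ _).
rewrite vanishing_setT; exact: (prime_ideal_preimage phi (prime_zero_ideal A)).
Qed.

(** The component [Y] corresponds to a prime of [A] minimal over [phi s]. By Krull's theorem a prime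
    below it is either the same, giving [Y], or zero, giving X. *)
Lemma component_coatom s Y : ~ vanishing [set: hypersurface F] s ->
  irreducible_closed Y -> Y `<=` zeros [set s] ->
  (forall W, irreducible_closed W -> Y `<=` W -> W `<=` zeros [set s] -> W = Y) ->
  irreducible_coatom Y.
Proof.
move=> ns irY Ys maxY; split=> [YT|Z irZ YZ].
  by apply: ns => x _; apply: Ys; rewrite ?YT.
have kerv W p : phi p = 0 -> vanishing (W : set (hypersurface F)) p.
  by move=> /phiP.2[q ->] x _; rewrite mevM mev_hypersurface mulr0.
have prY := prime_vanishing irY; have prZ := prime_vanishing irZ.
have [[cY _ _] [cZ _ _]] := (irY, irZ).
have [||||||E|E] := @krull_principal_ideal A (phi @` vanishing Y) (phi @` vanishing Z) (phi s).
- exact: noetherian_surj phi_surj (@noetherian_mpoly n K).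
- exact: prime_ideal_image (kerv Y).
- by exists s => // x /Ys; exact.
(* A prime between [phi s] and the prime of [Y] has a zero set between [Y] and the zeros of [s], so
   it is [Y]. *)
- move=> P' prP' P's P'Y.
  have pr' := prime_ideal_preimage phi prP'.
  have P'F : P' (phi F).
    have -> : phi F = 0 by apply/phiP.2; exists 1; rewrite mul1r.
    by case: prP' => [[]].
  suff E : phi @^-1` P' = vanishing Y.
    rewrite -E; apply/seteqP; split=> [a P'a|_ [p ? <-] //].
    by have [p pE] := phi_surj a; exists p; rewrite //= pE.
  rewrite -(vanishing_zeros pr' P'F); congr vanishing; apply: maxY.
  + exact: irreducible_zeros.
  + rewrite -(zerosK cY); apply: zerosS => p /P'Y.
    by rewrite (image_prime_idealE prY (kerv Y)).
  + by apply: zerosS => _ ->.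
- exact: prime_ideal_image (kerv Z).
- by move=> _ [p /(vanishingS YZ) Yp <-]; exists p.
- left; rewrite -(zerosK cY) -(zerosK cZ); congr zeros.
  apply/seteqP; split=> p.
    by rewrite -(image_prime_idealE prZ (kerv Z)) E (image_prime_idealE prY (kerv Y)).
  by rewrite -(image_prime_idealE prY (kerv Y)) -E (image_prime_idealE prZ (kerv Z)).
- right; rewrite -(zerosK cZ); apply/seteqP; split=> // x _ p.
  rewrite -(image_prime_idealE prZ (kerv Z)) E => /phiP.2[q ->].
  by rewrite mevM mev_hypersurface mulr0.
Qed.

End Codimension.

(** * Weighted homogeneous functions *)

Section WeightedAction.
Variables (n : nat) (K : closedFieldType) (w : 'I_n -> nat).
Implicit Types (p q g s : {mpoly K[n]}) (t : K).

(** Tested on values, so that 0 is homogeneous of every degree. *)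
Definition homogeneous e p : Prop :=
  forall t x, mev p (weighted_action w t x) = t ^+ e * mev p x.

Lemma homogeneousM a b p q :
  homogeneous a p -> homogeneous b q -> homogeneous (a + b) (p * q).
Proof. by move=> hp hq t x; rewrite !mevM hp hq exprD mulrACA. Qed.

Lemma homogeneousB a p q :
  homogeneous a p -> homogeneous a q -> homogeneous a (p - q).
Proof. by move=> hp hq t x; rewrite /mev !mevalB -!/(mev _ _) hp hq mulrBr. Qed.

Lemma homogeneous0 a : homogeneous a 0.
Proof. by move=> t x; rewrite !mev0 mulr0. Qed.

Lemma homogeneousX (m : 'X_{1..n}) : homogeneous (\sum_i w i * m i) 'X_[m].
Proof.
move=> t x; rewrite /mev !mevalX -prodrXr -big_split /=; apply: eq_bigr => i _.
by rewrite mxE exprMn exprM.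
Qed.

(** The parts of [p] have weights in the interval from [a] to [a + m], right end excluded, and may
    be 0. The length [m] is the Euclidean size of a Laurent polynomial; the offset [a] is a unit. *)
Definition spans_weights p a m : Prop :=
  exists2 h : nat -> {mpoly K[n]}, (forall k, homogeneous (a + k) (h k)) &
    p = \sum_(k < m) h k.

Lemma spans_weights_exists p : exists m, spans_weights p 0 m.
Proof.
elim/mpolyind: p => [|c m p _ _ [k [h hh ->]]].
  by exists 0%N, (fun=> 0) => [k|]; [exact: homogeneous0 | rewrite big_ord0].
pose e := (\sum_i w i * m i)%N.
exists (maxn k e.+1), (fun j =>
  (if j == e then c *: 'X_[m] else 0) + (if (j < k)%N then h j else 0)).
  move=> j t x; rewrite !mevD mulrDr; congr (_ + _).
    case: eqP => [->|_]; last exact: homogeneous0.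
    by rewrite /mev !mevalZ -!/(mev _ _) homogeneousX mulrCA.
  by case: ifP => _; [exact: hh | exact: homogeneous0].
rewrite big_split /=; congr (_ + _).
  have em : (e < maxn k e.+1)%N by rewrite leq_max ltnSn orbT.
  rewrite (bigD1 (Ordinal em)) //= eqxx big1 ?addr0 // => j.
  by rewrite -val_eqE /= => /negPf ->.
rewrite -big_mkcond /= (big_ord_widen_cond _ xpredT (fun j => h j) (leq_maxl k e.+1)) /=.
exact: eq_bigl.
Qed.

Variables (F : {mpoly K[n]}) (D : set (hypersurface F)).
Hypotheses (cD : closed D) (DT : D <> setT).

(* Division with remainder in the graded domain of functions on X: an element
   of I(D) with the fewest weights generates I(D) after inverting its top
   homogeneous term [s]. *)
Lemma generic_equation : exists g s e,
  [/\ vanishing D g, homogeneous e s, ~ vanishing [set: hypersurface F] s &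
      forall x : hypersurface F,
        mev g (set_val x) = 0 -> mev s (set_val x) <> 0 -> D x].
Proof.
pose P := vanishing D; pose J := vanishing [set: hypersurface F].
have [idP idJ] := (ideal_vanishing D, ideal_vanishing [set: hypersurface F]).
have [[m g] /= [[a [h hh gE]] [Pg Jg]] gmin] : exists2 mg : nat * {mpoly K[n]},
    (exists a, spans_weights mg.2 a mg.1) /\ P mg.2 /\ ~ J mg.2 &
    forall mh, (exists a, spans_weights mh.2 a mh.1) /\ P mh.2 /\ ~ J mh.2 ->
    (mg.1 <= mh.1)%N.
  apply: (@ex_min_measure _ (fun mg : nat * {mpoly K[n]} =>
     (exists a, spans_weights mg.2 a mg.1) /\ P mg.2 /\ ~ J mg.2) (fun mg => mg.1)).
  have [g /not_implyP[Pg Jg]] : exists g, ~ (P g -> J g).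
    apply/existsNP => PJ; apply: DT; apply/seteqP; split=> // x _.
    by rewrite -(zerosK cD) => p /PJ; exact.
  by have [m gm] := spans_weights_exists g; exists (m, g); split; first exists 0%N.
case: m => [|m] in gE gmin.
  by case: Jg; rewrite gE big_ord0; case: idJ.
have hg : homogeneous (a + m) (h m) by exact: hh.
(* If the top part vanished on X, dropping it would give a shorter element of I(D). *)
have Js : ~ J (h m).
  move=> Jhm; have : (m.+1 <= m)%N; last by rewrite ltnn.
  apply: (gmin (m, g - h m)) => /=; split; last first.
    split; last by move=> Jd; apply: Jg; exact: idealBK idJ Jd Jhm.
    by apply: (idealB idP) => // x _; exact: Jhm.
  by exists a, h => //; rewrite gE big_ord_recr /= addrK.
exists g, (h m), (a + m)%N; split=> // x gx sx; rewrite -(zerosK cD) => p Pp.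
have [l pl] := spans_weights_exists p.
elim: l p {1}0%N Pp pl => [|l IHl] p b Pp [h' hh' pE].
  by rewrite pE big_ord0 mev0.
have [lm|ml] := ltnP l.+1 m.+1.
  have : J p.
    apply: contrapT => Jp; have := gmin (l.+1, p); rewrite leqNgt lm /=.
    by move=> H; suff : false by []; apply: H; split=> //; exists b, h'.
  by apply.
(* One division step: the top parts cancel. The starting weight becomes [a + b + m], and the parts
   of [h' l * g] begin [l - m] places later. *)
pose p1 := h m * p - h' l * g.
have Pp1 : P p1 by apply: (idealB idP) => //; case: idP => _ _; apply.
have : mev p1 (set_val x) = 0.
  apply: (IHl _ (a + b + m)%N) => //.
  exists (fun k => h m * h' k - (if (l - m <= k)%N then h' l * h (k - (l - m))%N else 0)).
    move=> k; apply: homogeneousB.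
      rewrite (_ : (a + b + m + k) = (a + m) + (b + k))%N; last by lia.
      exact: homogeneousM.
    case: ifP => [lk|_]; last exact: homogeneous0.
    rewrite (_ : (a + b + m + k) = (b + l) + (a + (k - (l - m))))%N; first exact: homogeneousM.
    by lia.
  have -> : p1 = \sum_(k < l.+1) (h m * h' k -
      (if (l - m <= k)%N then h' l * h (k - (l - m))%N else 0)).
    rewrite sumrB -mulr_sumr -pE /p1; congr (_ - _).
    have lE : l.+1 = (m.+1 + (l - m))%N by lia.
    rewrite gE mulr_sumr -(big_mkord xpredT (fun k =>
      if (l - m <= k)%N then h' l * h (k - (l - m))%N else 0)).
    rewrite (@big_cat_nat _ _ _ (l - m)%N) //=; last by lia.
    rewrite [X in _ = X + _]big1_seq ?add0r; last first.
      by move=> k; rewrite mem_index_iota /= => kl; rewrite leqNgt kl.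
    rewrite -[X in \sum_(X <= _ < _) _]add0n lE big_addn addnK big_mkord.
    by apply: eq_bigr => k _; rewrite leq_addl addnK.
  by rewrite big_ord_recr /= leq_subr subKn // mulrC subrr addr0.
rewrite /p1 /mev mevalB !mevalM -!/(mev _ _) gx mulr0 subr0 => /eqP.
by rewrite mulf_eq0 => /orP[/eqP|/eqP].
Qed.
End WeightedAction.

(** * Orbits *)

Section Orbits.
Variables (n d : nat) (K : closedFieldType) (w : 'I_n -> nat) (F : {mpoly K[n]}).
Hypothesis qhF : quasi_homogeneous w d F.
Implicit Types (p q : {mpoly K[n]}) (t : K) (x y : punctured F).
Local Notation orb := (@orbit_map n K w F).

Lemma same_orbitP x y : reflect
  (exists2 t, t != 0 & set_val (set_val y) = weighted_action w t (set_val (set_val x)))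
  (same_orbit w x y).
Proof. by apply: (iffP (asboolP _)) => [[t [t0 yE]]|[t t0 yE]]; exists t. Qed.

Lemma mev_weighted_action p t (v : affine n K) :
  mev p (weighted_action w t v) = mev (p \mPo [tuple t ^+ w i *: 'X_i | i < n]) v.
Proof.
rewrite /mev comp_mpoly_meval; apply: meval_eq => i.
by rewrite mxE tnth_mktuple mevalZ mevalXU.
Qed.

(** The value at [t = 0] is included; with positive weights it is the value of [p] at the origin. *)
Lemma orbit_poly p (v : affine n K) :
  exists q : {poly K}, forall t, q.[t] = mev p (weighted_action w t v).
Proof.
exists (mmap (@polyC K) (fun i => ((v : 'rV[K]_n) 0 i) *: 'X^(w i)) p) => t.
rewrite /mev mevalE /mmap horner_sum; apply: eq_bigr => m _.
rewrite hornerM hornerC /mmap1 horner_prod; congr (_ * _); apply: eq_bigr => i _.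
by rewrite horner_exp hornerZ hornerXn mxE mulrC.
Qed.

Lemma weighted_action_hypersurface t (v : affine n K) : t != 0 ->
  mev F v = 0 -> mev F (weighted_action w t v) = 0.
Proof.
have [_ _ h] := qhF; move=> /h hF Fv.
by rewrite mev_weighted_action hF /mev mevalZ -/(mev _ _) Fv mulr0.
Qed.

Lemma weighted_action_neq0 t (v : affine n K) : t != 0 ->
  v <> (0 : 'rV[K]_n) -> weighted_action w t v <> (0 : 'rV[K]_n).
Proof.
move=> t0 v0 tv; apply: v0; apply/rowP => i; have /rowP/(_ i)/eqP := tv.
by rewrite !mxE mulf_eq0 expf_eq0 (negPf t0) andbF => /eqP.
Qed.

Lemma punctured_point (v : affine n K) : mev F v = 0 -> v <> (0 : 'rV[K]_n) ->
  exists x : punctured F, set_val (set_val x) = v.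
Proof.
move=> Fv v0.
have Xv : v \in hypersurface F by apply/mem_set.
have Uv : (exist _ v Xv : hypersurface F) \in punctured F.
  exact/mem_set.
by exists (exist _ (exist _ v Xv) Uv).
Qed.

Lemma punctured_action x t : t != 0 -> exists2 y, same_orbit w x y &
  set_val (set_val y) = weighted_action w t (set_val (set_val x)).
Proof.
move=> t0; have [|//|y yE] := @punctured_point (weighted_action w t (set_val (set_val x))).
- exact: weighted_action_hypersurface (mev_hypersurface _).
- by apply: weighted_action_neq0 => //; exact: (set_valP x).
- by exists y => //; apply/same_orbitP; exists t.
Qed.

Lemma closed_puncturedP (B : set (punctured F)) : closed B <->
  exists S : set {mpoly K[n]}, B = [set x | forall p, S p -> mev p (set_val (set_val x)) = 0].
Proof.
split=> [/closed_subspaceP[Z /closed_zerosP[S ->] ->]|[S ->]]; first by exists S.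
by apply/closed_subspaceP; exists (zeros S) => //; exact: closed_zeros.
Qed.

Definition saturated (B : set (punctured F)) : Prop :=
  forall x y, same_orbit w x y -> B x -> B y.

(** The largest saturated subset of [B]. It is closed when [B] is, being cut out by the torus
    translates of the equations of [B]. *)
Definition orbit_core (B : set (punctured F)) : set (punctured F) :=
  [set x | forall y, same_orbit w x y -> B y].

Lemma same_orbit_refl x : same_orbit w x x.
Proof. by case: (same_orbit_equiv w F). Qed.

Lemma same_orbit_trans x y z : same_orbit w x y -> same_orbit w y z -> same_orbit w x z.
Proof. by case: (same_orbit_equiv w F) => _ _ h; exact: h. Qed.

Lemma orbit_core_sub B : orbit_core B `<=` B.
Proof. by move=> x; apply; exact: same_orbit_refl. Qed.

Lemma saturated_orbit_core B : saturated (orbit_core B).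
Proof. by move=> x y xy Bx z yz; apply: Bx; exact: same_orbit_trans yz. Qed.

Lemma closed_orbit_core B : closed B -> closed (orbit_core B).
Proof.
move=> /closed_puncturedP[S ->]; apply/closed_puncturedP.
exists [set p | exists t q, [/\ t != 0, S q & p = q \mPo [tuple t ^+ w i *: 'X_i | i < n]]].
apply/seteqP; split=> [x Bx _ [t [q [t0 Sq ->]]]|x Bx y /same_orbitP[t t0 yE] p Sp].
  by have [y xy yE] := punctured_action x t0; rewrite -mev_weighted_action -yE; exact: Bx.
by rewrite yE mev_weighted_action; apply: Bx; exists t, p.
Qed.

(* The orbit is the image of the irreducible variety K^*. *)
Lemma orbit_cover B C x : closed B -> closed C ->
  (forall y, same_orbit w x y -> B y \/ C y) -> orbit_core B x \/ orbit_core C x.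
Proof.
move=> /closed_puncturedP[S ->] /closed_puncturedP[T ->] xBC.
apply: contrapT => /not_orP[].
move=> /existsNP[y /not_implyP[/same_orbitP[t t0 yE] /existsNP[p /not_implyP[Sp py]]]].
move=> /existsNP[z /not_implyP[/same_orbitP[u u0 zE] /existsNP[q /not_implyP[Tq qz]]]].
have [p' pE] := orbit_poly p (set_val (set_val x)).
have [q' qE] := orbit_poly q (set_val (set_val x)).
have p0 : p' != 0 by apply/eqP => p0; apply: py; rewrite yE -pE p0 horner0.
have q0 : q' != 0 by apply/eqP => q0; apply: qz; rewrite zE -qE q0 horner0.
(* The factor ['X] keeps [s] in the torus. *)
have /closed_nonrootP[s] : p' * q' * 'X != 0 by rewrite !mulf_neq0 ?polyX_eq0.
rewrite rootE !hornerM hornerX !mulf_eq0 !negb_or pE qE => /andP[/andP[ps qs] s0].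
have [v xv vE] := punctured_action x s0.
by have [/(_ _ Sp)|/(_ _ Tq)] := xBC _ xv; rewrite vE => /eqP; apply/negP.
Qed.

(** Testing on saturated closed sets is enough: [B] and [C] may be replaced by their cores, since
    every orbit in their union lies in one of them. *)
Lemma irreducible_closure_saturated (S : set (punctured F)) : saturated S -> S !=set0 ->
  (forall B C, closed B -> closed C -> saturated B -> saturated C ->
     S `<=` B `|` C -> S `<=` B \/ S `<=` C) ->
  irreducible_closed (closure S).
Proof.
move=> satS [x Sx] irS; split; first exact: closed_closure.
  by exists x; exact: subset_closure.
move=> B C cB cC SBC.
have [||||y Sy|SB|SC] := irS (orbit_core B) (orbit_core C).
- exact: closed_orbit_core.
- exact: closed_orbit_core.
- exact: saturated_orbit_core.
- exact: saturated_orbit_core.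
- apply: orbit_cover => // z yz; apply: SBC; apply: subset_closure; exact: satS yz Sy.
- by left; apply: closure_min => // z /SB /orbit_core_sub.
- by right; apply: closure_min => // z /SC /orbit_core_sub.
Qed.

Definition saturation (Y : set (punctured F)) : set (punctured F) :=
  [set y | exists2 x, Y x & same_orbit w x y].

Lemma sub_saturation Y : Y `<=` saturation Y.
Proof. by move=> x Yx; exists x => //; exact: same_orbit_refl. Qed.

Lemma saturated_saturation Y : saturated (saturation Y).
Proof. by move=> x y xy [z Yz zx]; exists z => //; exact: same_orbit_trans xy. Qed.

Lemma irreducible_closure_saturation Y : Y !=set0 ->
  (forall B C, closed B -> closed C -> Y `<=` B `|` C -> Y `<=` B \/ Y `<=` C) ->
  irreducible_closed (closure (saturation Y)).
Proof.
move=> [y Yy] irY; apply: irreducible_closure_saturated.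
- exact: saturated_saturation.
- by exists y; exact: sub_saturation.
have sub B : saturated B -> Y `<=` B -> saturation Y `<=` B.
  by move=> satB YB z [x /YB Bx xz]; exact: satB xz Bx.
move=> B C cB cC satB satC YBC.
have [||x Yx|YB|YC] := irY B C => //; first by apply: YBC; exact: sub_saturation.
  by left; exact: sub.
by right; exact: sub.
Qed.

(** The closure of the torus translates of [Y] is irreducible and stays in the proper subset [B], so
    maximality of [Y] makes it equal to [Y]. *)
Lemma saturated_coatom Y B : irreducible_closed Y -> irreducible_coatom Y ->
  closed B -> B <> setT -> saturated B -> Y `<=` B -> saturated Y.
Proof.
move=> [cY Y0 irY] [YT coY] cB BT satB YB.
have irW := irreducible_closure_saturation Y0 irY.
have WB : closure (saturation Y) `<=` B.
  by apply: closure_min => // y [x /YB Bx xy]; exact: satB xy Bx.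
have YW : Y `<=` closure (saturation Y).
  by apply: subset_trans (@subset_closure _ _); exact: sub_saturation.
have [WY|WT] := coY _ irW YW; last first.
  by case: BT; apply/seteqP; split=> // x _; apply: WB; rewrite WT.
move=> x y xy Yx; rewrite -WY; apply: subset_closure; exists x => //.
Qed.

Lemma orbit_mapP x y : orb x = orb y <-> same_orbit w x y.
Proof. by split=> [/eqmodP|xy]; [|apply/eqmodP]. Qed.

Lemma orbit_map_surj (z : orbit_space w F) : exists x, orb x = z.
Proof. by exists (repr z); rewrite /orbit_map reprK. Qed.

Lemma closed_orbit_space (C : set (orbit_space w F)) :
  closed C <-> closed (orb @^-1` C).
Proof. by rewrite -!openC. Qed.

Lemma preimage_orbit_image Y : saturated Y -> orb @^-1` (orb @` Y) = Y.
Proof.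
move=> satY; apply/seteqP; split=> [x [y Yy /orbit_mapP yx]|x Yx]; last by exists x.
exact: satY yx Yy.
Qed.

Lemma saturated_preimage (C : set (orbit_space w F)) : saturated (orb @^-1` C).
Proof. by move=> x y /orbit_mapP xy; rewrite /= xy. Qed.

(** The preimage is saturated, so it is tested on saturated closed sets, and these descend to closed
    sets of the quotient. *)
Lemma irreducible_orbit_preimage (C : set (orbit_space w F)) :
  irreducible_closed C -> irreducible_closed (orb @^-1` C).
Proof.
move=> [/closed_orbit_space cC [c Cc] irC].
rewrite [X in irreducible_closed X](closure_id _).1 //.
apply: irreducible_closure_saturated; first exact: saturated_preimage.
  by have [x xE] := orbit_map_surj c; exists x; rewrite /= xE.
move=> A B cA cB satA satB CAB.
have [||z Cz|CA|CB] := irC (orb @` A) (orb @` B).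
- by apply/closed_orbit_space; rewrite preimage_orbit_image.
- by apply/closed_orbit_space; rewrite preimage_orbit_image.
- by have [x xE] := orbit_map_surj z; move: Cz; rewrite -xE => /CAB[]; [left|right]; exists x.
- by left=> x Cx; rewrite -(preimage_orbit_image satA); exact: CA.
- by right=> x Cx; rewrite -(preimage_orbit_image satB); exact: CB.
Qed.

Lemma irreducible_orbit_image Y :
  saturated Y -> irreducible_closed Y -> irreducible_closed (orb @` Y).
Proof.
move=> satY [cY [y Yy] irY]; split.
- by apply/closed_orbit_space; rewrite preimage_orbit_image.
- by exists (orb y), y.
move=> A B /closed_orbit_space cA /closed_orbit_space cB YAB.
have [//|//|x Yx|YA|YB] := irY (orb @^-1` A) (orb @^-1` B).
- by apply: YAB; exists x.
- by left=> _ [x Yx <-]; exact: YA.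
- by right=> _ [x Yx <-]; exact: YB.
Qed.

Lemma coatom_orbit_image Y : saturated Y -> irreducible_coatom Y ->
  irreducible_coatom (orb @` Y).
Proof.
move=> satY [YT coY]; split=> [E|Z irZ YZ].
  by apply: YT; rewrite -(preimage_orbit_image satY) E.
have ZE : orb @` (orb @^-1` Z) = Z.
  apply/seteqP; split=> [_ [x Zx <-] //|z Zz].
  by have [x xE] := orbit_map_surj z; exists x; rewrite /= xE.
have [|ZY|ZT] := coY _ (irreducible_orbit_preimage irZ).
- by move=> x Yx; apply: YZ; exists x.
- by left; rewrite -ZY ZE.
- right; rewrite -ZE ZT; apply/seteqP; split=> // z _.
  by have [x] := orbit_map_surj z; exists x.
Qed.

End Orbits.

(** * The origin is not a divisor *)

Section MeetsPunctured.
Variables (n d : nat) (K : closedFieldType) (w : 'I_n -> nat) (F : {mpoly K[n]}).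
Hypothesis qhF : quasi_homogeneous w d F.
Hypothesis n_ge3 : (3 <= n)%N.

Lemma mev_curve p (c : 'I_n -> {poly K}) t :
  (mmap (@polyC K) c p).[t] = mev p (\row_i (c i).[t]).
Proof.
rewrite /mev mevalE /mmap horner_sum; apply: eq_bigr => m _.
rewrite hornerM hornerC /mmap1 horner_prod; congr (_ * _); apply: eq_bigr => i _.
by rewrite horner_exp mxE.
Qed.

Lemma ord_pair (i : 'I_n) : exists j k : 'I_n, [/\ j != i, k != i & j != k].
Proof.
have n0 : (0 < n)%N by apply: leq_trans n_ge3.
have n1 : (1 < n)%N by apply: leq_trans n_ge3.
have [i0|i0] := eqVneq i (Ordinal n0).
  by exists (Ordinal n1), (Ordinal n_ge3); rewrite i0.
have [i1|i1] := eqVneq i (Ordinal n1).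
  by exists (Ordinal n0), (Ordinal n_ge3); rewrite i1.
by exists (Ordinal n0), (Ordinal n1); rewrite !(eq_sym _ i).
Qed.

(* Otherwise the restriction G of F to a coordinate plane in x_i = 0 vanishes at
   most at the origin, so G(1, z) and G(y, 1) are constant, which contradicts
   quasi-homogeneity. *)
Lemma punctured_coord0 (i : 'I_n) :
  exists x : punctured F, (set_val (set_val x) : 'rV[K]_n) 0 i = 0.
Proof.
have [j [k [ji ki jk]]] := ord_pair i.
pose pt (y z : K) : affine n K := \row_l (if l == j then y else if l == k then z else 0).
pose G y z := mev F (pt y z).
apply: contrapT => noX.
have G0 y z : (y != 0) || (z != 0) -> G y z != 0.
  move=> yz; apply/eqP => Gyz; apply: noX.
  have [|x xE] := punctured_point Gyz.
    move=> /rowP E; have := E j; have := E k.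
    rewrite !mxE eqxx (eq_sym k) (negPf jk) eqxx => z0 y0.
    by move: yz; rewrite y0 z0 eqxx.
  by exists x; rewrite xE mxE !(eq_sym i) (negPf ji) (negPf ki).
have const (q : {poly K}) : (forall z, q.[z] != 0) -> forall z, q.[z] = q.[0].
  move=> q0; have [/closed_rootP[z /rootP qz]|] := boolP (size q != 1%N).
    by have := q0 z; rewrite qz eqxx.
  by rewrite negbK => /size_poly1P[c _ ->] z; rewrite !hornerC.
have G1z z : G 1 z = G 1 0.
  pose q := mmap (@polyC K) (fun l => if l == j then 1 else if l == k then 'X else 0) F.
  have qE u : q.[u] = G 1 u.
    rewrite mev_curve /G; congr mev; apply/rowP => l; rewrite !mxE.
    by case: ifP => _; [rewrite hornerC | case: ifP => _; rewrite ?hornerX ?horner0].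
  by rewrite -!qE const // => u; rewrite qE G0 ?oner_neq0.
have Gy1 y : G y 1 = G 0 1.
  pose q := mmap (@polyC K) (fun l => if l == j then 'X else if l == k then 1 else 0) F.
  have qE u : q.[u] = G u 1.
    rewrite mev_curve /G; congr mev; apply/rowP => l; rewrite !mxE.
    by case: ifP => _; [rewrite hornerX | case: ifP => _; rewrite ?hornerC ?horner0].
  by rewrite -!qE const // => u; rewrite qE G0 ?oner_neq0 ?orbT.
have Gt t y z : t != 0 -> G (t ^+ w j * y) (t ^+ w k * z) = t ^+ d * G y z.
  move=> t0; have [_ _ /(_ t t0) hF] := qhF.
  have := mev_weighted_action w F t (pt y z).
  rewrite hF /mev mevalZ -!/(mev _ _) => <-; congr mev; apply/rowP => l; rewrite !mxE.
  by case: eqP => [->//|_]; case: eqP => [->//|_]; rewrite mulr0.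
have [_ d0 _] := qhF.
have /closed_nonrootP[t] : 'X * ('X^d - 1) != 0 :> {poly K}.
  by rewrite mulf_neq0 ?polyX_eq0 // -size_poly_eq0 size_XnsubC.
rewrite rootE !hornerE mulf_eq0 negb_or => /andP[t0 /negP]; apply.
(* Both restrictions of [G] have the constant value [G 1 1]. Scaling this point to second coordinate
   1 forces [t ^+ d = 1], against the choice of [t]. *)
have := Gt t 1 (t ^+ w k)^-1 t0.
rewrite mulr1 divff ?expf_neq0 // Gy1 -(Gy1 1) !G1z => /eqP.
rewrite -{1}[G 1 0]mul1r (inj_eq (mulIf _)) ?G0 ?oner_neq0 // eq_sym.
by rewrite subr_eq0.
Qed.

Hypothesis irX : irreducible_closed [set: hypersurface F].

Lemma open_punctured : open (punctured F).
Proof.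
rewrite -closedC (_ : ~` _ = zeros [set p | exists i, p = 'X_i]); first exact: closed_zeros.
apply/seteqP; split=> [x /contrapT x0 _ [i ->]|x Xx].
  by rewrite /mev mevalXU x0 mxE.
move=> /=; apply; apply/rowP => i; rewrite mxE -(Xx 'X_i); last by exists i.
by rewrite /mev mevalXU.
Qed.

(* The closure of an orbit lies strictly between the origin and X, so the origin
   has codimension at least two. *)
Lemma coatom_meets_punctured Y : irreducible_closed Y -> irreducible_coatom Y ->
  Y `&` punctured F !=set0.
Proof.
move=> irY [YT coY]; have [cY [y Yy] _] := irY; apply: contrapT => noU.
have Y0 z : Y z -> is_origin z by move=> Yz; apply: contrapT => z0; apply: noU; exists z.
have [x _] := punctured_coord0 (Ordinal n_ge3).
pose v := set_val (set_val x).
have [i vi] : exists i, (v : 'rV[K]_n) 0 i != 0.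
  apply: contrapT => /forallNP v0; apply: (set_valP x); apply/rowP => i.
  by rewrite mxE; apply/eqP; have /negP := v0 i; rewrite negbK.
pose W0 := closure (saturation w [set x]).
have irW0 : irreducible_closed W0.
  apply: (irreducible_closure_saturation qhF); first by exists x.
  by move=> B C _ _ /(_ x erefl)[Bx|Cx]; [left|right] => _ ->.
pose W := closure (set_val @` W0).
have irW : irreducible_closed W by exact: irreducible_closure.
have orbitW t : t != 0 -> exists2 z, W z & set_val z = weighted_action w t v.
  move=> t0; have [z xz zE] := punctured_action qhF x t0.
  exists (set_val z) => //; apply: subset_closure; exists z => //.
  by apply: subset_closure; exists x.
(* A function vanishing on the orbit of [v] is zero as a polynomial in [t], hence vanishes at the
   origin, where [t = 0]. *)
have YW : Y `<=` W.
  move=> z /Y0 z0; have [cW _ _] := irW; rewrite -(zerosK cW) => p Wp.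
  have [q qE] := orbit_poly w p v.
  have q0 : q = 0.
    apply/eqP/negPn/negP => q0.
    have /closed_nonrootP[t] : q * 'X != 0 by rewrite mulf_neq0 ?polyX_eq0.
    rewrite rootE hornerM hornerX mulf_eq0 negb_or qE => /andP[+ t0].
    by have [u Wu <-] := orbitW t t0; rewrite (Wp _ Wu) eqxx.
  have := qE 0; rewrite q0 horner0 => ->; congr mev; rewrite z0; apply/rowP => l.
  by have [w0 _ _] := qhF; rewrite !mxE expr0n gtn_eqF // mul0r.
have [WY|WT] := coY W irW YW.
  apply: noU; exists (set_val x); split; last exact: (set_valP x).
  rewrite -WY; apply: subset_closure; exists x => //; apply: subset_closure.
  exact: sub_saturation.
have [x' x'i] := punctured_coord0 i; pose v' := set_val (set_val x').
apply: (set_valP x'); apply/rowP => j; rewrite mxE.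
(* This binomial vanishes on the orbit of [v]. If the orbit were dense in X, it would vanish at [x']
   too; as coordinate [i] is zero there and nonzero in [v], coordinate [j] of [x'] would be zero for
   every [j]. *)
pose b := v 0 j ^+ w i *: 'X_i ^+ w j - v 0 i ^+ w j *: 'X_j ^+ w i : {mpoly K[n]}.
have bE u : mev b u = v 0 j ^+ w i * u 0 i ^+ w j - v 0 i ^+ w j * u 0 j ^+ w i.
  by rewrite /mev mevalB !mevalZ !rmorphXn /= !mevalXU.
have : mev b v' = 0.
  suff Wb : W `<=` zeros [set b] by apply: (Wb (set_val x')); rewrite ?WT.
  apply: closure_min; first exact: closed_zeros.
  suff W0b : W0 `<=` set_val @^-1` zeros [set b] by move=> _ [z /W0b zb <-].
  apply: closure_min.
    by apply/closed_subspaceP; exists (zeros [set b]) => //; exact: closed_zeros.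
  move=> z [_ -> /same_orbitP[t t0 zE]] _ ->; rewrite zE bE !mxE !exprMn -!exprM.
  by rewrite (mulnC (w j)) mulrCA [X in _ - X]mulrCA (mulrC (_ ^+ _) (v 0 i ^+ _)) subrr.
have [w0 _ _] := qhF.
rewrite bE x'i expr0n gtn_eqF // mulr0 sub0r => /eqP.
by rewrite oppr_eq0 mulf_eq0 !expf_eq0 (negPf vi) andbF w0 => /eqP.
Qed.

End MeetsPunctured.

(** * Linkage *)

Lemma coeff_sum_freegU (T : choiceType) (L : seq T) (x : T) :
  coeff x (\sum_(y <- L) << y >> : {freeg T / int}) = (count_mem x L)%:R.
Proof.
rewrite raddf_sum /= -sum1_count natr_sum [RHS]big_mkcond /=.
by apply: eq_bigr => y _; rewrite coeffU mul1r; case: eqP.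
Qed.

Section Linkage.
Variables (n d : nat) (K : closedFieldType) (w : 'I_n -> nat) (F : {mpoly K[n]}).
Hypotheses (n_ge3 : (3 <= n)%N) (qhF : quasi_homogeneous w d F).
Hypothesis irX : irreducible_closed [set: hypersurface F].

Let TU : [set: hypersurface F] `&` punctured F !=set0.
Proof.
have [x _] := punctured_coord0 qhF n_ge3 (Ordinal n_ge3).
by exists (set_val x); split=> //; exact: (set_valP x).
Qed.

Lemma irreducible_punctured : irreducible_closed [set: punctured F].
Proof. by have := irreducible_preimage (open_punctured F) irX TU. Qed.

Lemma punctured_zeros_neqT s : ~ vanishing [set: hypersurface F] s ->
  (set_val @^-1` zeros [set s] : set (punctured F)) <> setT.
Proof.
move=> ns E; apply: ns => x _.
suff Ts : [set: hypersurface F] `<=` zeros [set s] by exact: (Ts x).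
rewrite -(closure_preimage (open_punctured F) irX TU).
apply: closure_min; first exact: closed_zeros.
by move=> _ [y _ <-]; have : [set: punctured F] y by []; rewrite -E.
Qed.

Lemma saturated_zeros e s : homogeneous w e s ->
  saturated w (set_val @^-1` zeros [set s] : set (punctured F)).
Proof.
move=> hs x y /same_orbitP[t t0 yE] sx _ ->.
by rewrite yE hs (sx s) ?mulr0.
Qed.

(** The trace of [Y] on X^* is a coatom inside the saturated zeros of [s], hence saturated. It is
    therefore the preimage of its image in the orbit space, which is again a coatom. *)
Lemma coatom_Cstar_divisor e s (Y : set (hypersurface F)) : homogeneous w e s ->
  ~ vanishing [set: hypersurface F] s -> irreducible_closed Y ->
  irreducible_coatom Y -> Y `<=` zeros [set s] -> integral_Cstar_divisor w Y.
Proof.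
move=> hs ns irY coY Ys; split; first exact: coatom_integral_divisor.
have oU := open_punctured F.
have YU := coatom_meets_punctured qhF n_ge3 irY coY.
have irY0 := irreducible_preimage oU irY YU.
have coY0 := coatom_preimage oU irX irY YU coY.
have satY0 : saturated w (set_val @^-1` Y : set (punctured F)).
  apply: (saturated_coatom qhF irY0 coY0 _ (punctured_zeros_neqT ns) (saturated_zeros hs)).
    by apply/closed_subspaceP; exists (zeros [set s]) => //; exact: closed_zeros.
  by move=> x /Ys.
exists (set_val @^-1` Y); split; last by rewrite closure_preimage.
split; first exact: coatom_integral_divisor irreducible_punctured irY0 coY0.
exists (@orbit_map n K w F @` (set_val @^-1` Y)).
split; last by rewrite preimage_orbit_image.
apply: coatom_integral_divisor; last exact: coatom_orbit_image qhF _ satY0 coY0.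
- rewrite (_ : setT = @orbit_map n K w F @` setT).
    exact: irreducible_orbit_image _ irreducible_punctured.
  by apply/seteqP; split=> // z _; have [x <-] := orbit_map_surj z; exists x.
- exact: irreducible_orbit_image.
Qed.

(** The zeros of [s] are saturated, so the complement of their image is a nonempty open set of the
    quotient, which the image of [D] must meet. *)
Lemma horizontal_not_sub_zeros e s (D : set (hypersurface F)) : homogeneous w e s ->
  ~ vanishing [set: hypersurface F] s -> horizontal w D -> ~ (D `<=` zeros [set s]).
Proof.
move=> hs ns hD Ds; pose B := set_val @^-1` zeros [set s] : set (punctured F).
have satB : saturated w B := saturated_zeros hs.
have cB : closed B.
  by apply/closed_subspaceP; exists (zeros [set s]) => //; exact: closed_zeros.
have [||z [Bz [x Dx xz]]] := hD (~` (@orbit_map n K w F @` B)).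
- apply: contrapT => B0; apply: (punctured_zeros_neqT ns); apply/seteqP; split=> // x _.
  rewrite -[_ x]/(B x) -(preimage_orbit_image satB); apply: contrapT => Bx; apply: B0.
  by exists (@orbit_map n K w F x).
- by apply: closed_openC; apply/closed_orbit_space; rewrite preimage_orbit_image.
- by apply: Bz; exists x => //; exact: Ds.
Qed.

End Linkage.

Theorem theorem3p3 (R : realType) (n d : nat) (w : 'I_n -> nat)
    (F : {mpoly R[i][n]}) (D : set (hypersurface F)) :
  (3 <= n)%N ->
  quasi_homogeneous w d F ->
  integral_normal F ->
  isolated_singularity F ->
  integral_divisor D ->
  horizontal w D ->
  exists E : divisor F,
    [/\ Cstar_divisor w E, effective E & CI_linked << D >> E].
Proof.
move=> n_ge3 qhF [A [phi [phiP _]]] _ divD hD.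
have irX := irreducible_hypersurface phiP.
have [[cD _ _] _] := divD.
have [g [s [e [Dg hs ns gsD]]]] := generic_equation w cD (integral_divisor_neqT divD).
have [L LE irL] := irreducible_decomposition (@closed_zeros _ _ F [set s]).
have Ls Y : Y \in L -> Y `<=` zeros [set s] by move=> YL x Yx; apply/LE; exists Y.
(* The multiplicities count occurrences in [L]; linkage depends only on the support. *)
pose E : divisor F := \sum_(Y <- L) << Y >>.
have coeffE Y : coeff Y E != 0 <-> Y \in L.
  by rewrite coeff_sum_freegU pnatr_eq0 -lt0n -has_count has_pred1.
exists E; split.
- move=> Y /coeffE YL; have [irY maxY] := irL Y YL.
  apply: (coatom_Cstar_divisor n_ge3 qhF irX hs ns irY) (Ls Y YL).
  exact: component_coatom phiP _ _ ns irY (Ls Y YL) maxY.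
- by move=> Y; rewrite coeff_sum_freegU ler0n.
split.
  move=> DE; apply: (horizontal_not_sub_zeros n_ge3 qhF irX hs ns hD).
  by apply: Ls; apply/coeffE; rewrite -DE coeffU eqxx.
exists (g * s); apply/seteqP; split=> [x [[Y]|[Y /coeffE YL Yx]]|x].
- rewrite coeffU mul1r pnatr_eq0 eqb0 negbK => /eqP <- Dx.
  by rewrite /hypersurface_section /= mevM Dg // mul0r.
- by rewrite /hypersurface_section /= mevM (Ls Y YL x Yx s erefl) mulr0.
rewrite /hypersurface_section /= mevM => /eqP; rewrite mulf_eq0 => gs.
have [sx|sx] := eqVneq (mev s (set_val x)) 0; last first.
  left; exists D; first by rewrite coeffU eqxx.
  by apply: gsD; apply/eqP => //; move: gs; rewrite (negPf sx) orbF.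
have /LE[Y YL Yx] : zeros [set s] x by move=> _ ->.
by right; exists Y => //; apply/coeffE.
Qed.
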